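(* Let $n\ge 0$ be an integer and let $s_0,s_1,\dots,s_{2n}$ be real numbers (the data of the Hamburger moment problem). Let $w$ be a function of the class $\mathfrak R(\mathbb H)$ and suppose that the Fundamental Matrix Inequality FMI($\mathcal H$) $$\begin{bmatrix} A & B_w(z)\\ B_w^{*}(z) & \dfrac{w(z)-w^{*}(z)}{z-\bar z}\end{bmatrix}\ge 0$$ is satisfied at every point $z$ of the upper half plane $\mathbb H$. Then $w$ is representable in the form $$w(z)=w_\sigma(z)=\int_{\mathbb R}\frac{d\sigma(\lambda)}{\lambda-z}\qquad(z\in\mathbb C\setminus\mathbb R)$$ for some uniquely determined finite nonnegative measure $\sigma$ on $\mathbb R$. This measure satisfies the moment conditions: the moments $s_k(\sigma)=\int_{\mathbb R}\lambda^k\,d\sigma(\lambda)$, $k=0,1,\dots,2n$, exist and $$s_k(\sigma)=s_k\quad(k=0,1,\dots,2n-1),\qquad s_{2n}(\sigma)\le s_{2n}.$$ Moreover the interpolation condition $$\Big|z^{2n}\Big(w(z)+\sum_{0\le j\le 2n-1}\frac{s_j}{z^{j+1}}\Big)\Big|\le\frac{s_{2n}}{|z|}\,(1+o(1))\qquad(|z|\to\infty,\ z=iy)$$ is satisfied.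
   Context: $\mathbb H$ is the open upper half plane; $^{*}$ denotes the conjugate transpose (complex conjugate for scalars, so $w^{*}(z)=\overline{w(z)}$). The class $\mathfrak R(\mathbb H)$ consists of the scalar functions $w$ that are holomorphic in $\mathbb C\setminus\mathbb R$ and satisfy $w(z)=w^{*}(\bar z)$ and $\dfrac{w(z)-w^{*}(z)}{z-\bar z}\ge0$ for all $z\in\mathbb C\setminus\mathbb R$. Given real $s_0,\dots,s_{2n}$, index coordinates by $0,\dots,n$ and put: $A=[s_{k+l}]_{0\le k,l\le n}$ (the Hankel matrix, of size $(n+1)\times(n+1)$); $u=(1,0,\dots,0)^{T}$ and $v=(0,-s_0,-s_1,\dots,-s_{n-1})^{T}$, column vectors of length $n+1$; $T$ the $(n+1)\times(n+1)$ lower shift matrix, with entries $T_{k,k-1}=1$ ($1\le k\le n$) and all other entries $0$. The column $B_w$ is $$B_w(z)=(I-zT)^{-1}\big(u\,w(z)-v\big),$$ i.e. its $k$-th entry is $b_{w,k}(z)=z^kw(z)+\sum_{0\le j\le k-1}z^{k-1-j}s_j$, $0\le k\le n$. The notation $M\ge0$ for a matrix means Hermitian positive semidefinite. *)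

(* Defs.v *)
From HB Require Import structures.
From mathcomp Require Import all_boot all_order all_algebra.
From mathcomp Require Import complex.
From mathcomp Require Import all_classical all_reals all_analysis.

Set Implicit Arguments.
Unset Strict Implicit.
Unset Printing Implicit Defensive.

Import Order.TTheory GRing.Theory Num.Theory.
Import numFieldNormedType.Exports.

Local Open Scope classical_set_scope.
Local Open Scope complex_scope.
Local Open Scope sesquilinear_scope.
Local Open Scope ring_scope.

(* [z^*] is the conjugation of [R[i]] as a [numClosedFieldType], and [M ^t*]
   the conjugate transpose; [complex.Re] and [complex.Im] are [R]-valued.  An
   inequality [0 <= z] in [R[i]] says that [z] is real and nonnegative. *)

Section ComplexFunctions.
Context {R : realType}.
Local Notation C := (R[i]).

(* The values of [w] on the real line are never used.  [C^o] is [C] as a normed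
   space over itself, so that [derivable] is complex differentiability. *)
Definition holomorphic_off_real (w : C -> C) : Prop :=
  forall z : C, complex.Im z != 0 -> derivable (w : C^o -> C^o) z 1.

Definition nevanlinna (w : C -> C) : Prop :=
  [/\ holomorphic_off_real w,
      forall z : C, complex.Im z != 0 -> w z = (w z^*)^* &
      forall z : C, complex.Im z != 0 -> 0 <= (w z - (w z)^*) / (z - z^*)].

Definition psdmx (m : nat) (M : 'M[C]_m) : Prop :=
  M \is hermsymmx /\ forall x : 'cV[C]_m, 0 <= (x ^t* *m M *m x) 0 0.

End ComplexFunctions.

Section HamburgerFMI.
Context {R : realType}.
Local Notation C := (R[i]).

(* A sequence [s : nat -> R] carries the data; only [s 0, ..., s (2 * n)] occur
   in the definitions below taken at [n]. *)
Definition hankel (n : nat) (s : nat -> R) : 'M[C]_n.+1 :=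
  \matrix_(k, l) (s (k + l)%N)%:C.

Definition shiftmx (n : nat) : 'M[C]_n.+1 :=
  \matrix_(k, l) (k == l.+1 :> nat)%:R.

Definition fmi_u (n : nat) : 'cV[C]_n.+1 :=
  \col_k (k == 0%N :> nat)%:R.

Definition fmi_v (n : nat) (s : nat -> R) : 'cV[C]_n.+1 :=
  \col_k (if k == 0%N :> nat then 0 else - (s k.-1)%:C).

Definition fmi_B (n : nat) (s : nat -> R) (w : C -> C) (z : C) : 'cV[C]_n.+1 :=
  invmx (1%:M - z *: shiftmx n) *m (w z *: fmi_u n - fmi_v n s).

Definition fmi_mx (n : nat) (s : nat -> R) (w : C -> C) (z : C)
    : 'M[C]_(n.+1 + 1) :=
  block_mx (hankel n s)          (fmi_B n s w z)
           ((fmi_B n s w z) ^t*) (((w z - (w z)^*) / (z - z^*))%:M).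

Lemma unitmx_fmi_resolvent (n : nat) (z : C) :
  1%:M - z *: shiftmx n \in unitmx.
Proof.
rewrite unitmxE det_trig.
  rewrite big1 ?unitr1// => i _.
  by rewrite !mxE eqxx ltn_eqF// mulr0 subr0.
apply/is_trig_mxP => i j ij; rewrite !mxE.
rewrite (_ : (i == j) = false); last by apply/negbTE; rewrite neq_ltn ij.
by rewrite ltn_eqF ?mulr0 ?subr0// ltnW.
Qed.

Lemma fmi_BE (n : nat) (s : nat -> R) (w : C -> C) (z : C) (k : 'I_n.+1) :
  fmi_B n s w z k 0 =
    z ^+ k * w z + \sum_(j < k) z ^+ (k.-1 - j) * (s j)%:C.
Proof.
pose b k := z ^+ k * w z + \sum_(j < k) z ^+ (k.-1 - j) * (s j)%:C.
suff -> : fmi_B n s w z = \col_(k < n.+1) b k by rewrite mxE.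
apply: (canLR (mulKmx (unitmx_fmi_resolvent n z))).
apply/colP => {}k; rewrite mulmxBl mul1mx -scalemxAl !mxE.
case: k => [[|k] ltk] /=.
  rewrite /b expr0 mul1r big_ord0 addr0 mulr1 subr0 big1 ?mulr0 ?subr0// => i _.
  by rewrite !mxE /= mul0r.
rewrite mulr0 sub0r opprK (bigD1 (Ordinal (ltnW ltk))) //= !mxE /= eqxx mul1r.
rewrite big1 ?addr0 => [|i ni]; last first.
  rewrite !mxE eqSS [k == i]eq_sym (_ : (i == k :> nat) = false) ?mul0r//.
  by apply/negbTE; move: ni; rewrite -val_eqE.
rewrite /b exprS mulrDr -mulrA opprD addrACA subrr add0r big_ord_recr /=.
rewrite subnn expr0 mul1r mulr_sumr addrAC -[LHS]add0r; congr (_ + _).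
apply/esym/eqP; rewrite subr_eq0; apply/eqP/eq_bigr => i _.
rewrite mulrA -exprS; congr (z ^+ _ * _).
by case: i => i /= ik; case: k ik {ltk} => //= k ik; rewrite subSn.
Qed.

End HamburgerFMI.

Section Measures.
Context {R : realType}.
Local Notation C := (R[i]).

Definition cintegral (mu : {measure set (measurableTypeR R) -> \bar R})
    (f : R -> C) : C :=
  (Rintegral mu setT (fun t => complex.Re (f t)))
    +i* (Rintegral mu setT (fun t => complex.Im (f t))).

Definition stieltjes (mu : {measure set (measurableTypeR R) -> \bar R})
    (z : C) : C :=
  cintegral mu (fun t => (t%:C - z)^-1).

Definition represents (mu : {measure set (measurableTypeR R) -> \bar R})
    (w : C -> C) : Prop :=
  forall z : C, complex.Im z != 0 -> w z = stieltjes mu z.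

Definition has_moment (mu : {measure set (measurableTypeR R) -> \bar R})
    (k : nat) : Prop :=
  mu.-integrable setT (fun t : R => (t ^+ k)%:E).

Definition moment (mu : {measure set (measurableTypeR R) -> \bar R})
    (k : nat) : R :=
  Rintegral mu setT (fun t : R => t ^+ k).

End Measures.

Section Interpolation.
Context {R : realType}.
Local Notation C := (R[i]).

Definition interpolation_bound (n : nat) (s : nat -> R) (w : C -> C)
    (z : C) (e : R) : Prop :=
  `| z ^+ (2 * n) * (w z + \sum_(j < 2 * n) (s j)%:C / z ^+ j.+1) |
    <= (s (2 * n)%N)%:C / `|z| * (1 + e%:C).

(* The limit is over the whole imaginary axis, that is, for both signs of [y];
   [eps] is the [o(1)], as a function of [y]. *)
Definition interpolation_cond (n : nat) (s : nat -> R) (w : C -> C) : Prop :=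
  exists eps : R -> R,
    [/\ eps y @[y --> +oo] --> 0,
        eps y @[y --> -oo] --> 0,
        \forall y \near +oo, interpolation_bound n s w (0 +i* y) (eps y) &
        \forall y \near -oo, interpolation_bound n s w (0 +i* y) (eps y)].

End Interpolation.

(* Main.v *)
(* Write [b_0 = w] and [b_(k+1) = z b_k + s_k].  Testing the matrix inequality on
   suitable vectors gives [|w z| <= s_0 / Im z] and [Im (z b_(2m+1) z) >= 0] for
   [m <= n].  The first bound makes [w] the Stieltjes transform of a finite
   measure [sigma]: on each line [Im = 1/k] the Poisson formula holds (Goursat's
   theorem on rectangles, applied to a kernel that is only continuous at the
   pole), and Helly selection extracts [sigma] from the densities [Im w].  By
   induction on [m], if the moments below [2m] agree then [b_(2m)] is the Cauchy
   integral of [t^(2m) dsigma], and [Im (z b_(2m+3) z) >= 0] on the rays [i R_+]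
   and [(i +- 1) R_+] yields the moments [2m], [2m+1], [2m+2].  Finally
   [|b_(2n)(iy)| <= s_(2n)(sigma) / |y|], so the interpolation condition holds
   without any error term. *)

Require Import Defs.
From HB Require Import structures.
From mathcomp Require Import all_boot all_order all_algebra.
From mathcomp Require Import complex.
From mathcomp Require Import all_classical all_reals all_analysis.
From mathcomp Require Import measurable_realfun.
From mathcomp Require Import ring lra.
Import Order.TTheory GRing.Theory Num.Theory.
Import numFieldNormedType.Exports.
Local Open Scope classical_set_scope.
Local Open Scope complex_scope.
Local Open Scope ring_scope.

Set Implicit Arguments.
Unset Strict Implicit.
Unset Printing Implicit Defensive.

(** * Goursat's theorem on a rectangle *)

Section Goursat.
Context {R : realType}.
Implicit Types (a b c d x y : R) (P Q : R -> R -> R).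
Local Notation mu := (@lebesgue_measure R).

(** No boundary values of [w] on the real line are available, hence the shifted lines:
    [w (z + i / k)] is holomorphic across the real axis and bounded on the closed half-plane.
    Subtracting the value at the pole leaves a continuous kernel, so that neither residues nor small
    circles occur. The Poisson formula identifies imaginary parts only; [w] equals the transform
    because their difference has zero derivative and decays along vertical rays.

    On the imaginary ray [z^2] is real, so [s_(2m+1)] drops out of the imaginary part of
    [z b_(2m+3)]. On the two diagonal rays [z^2] is purely imaginary, and [s_(2m+1)] enters with a
    factor of order [|z|^2] whose sign depends on the ray; the two signs together force an equality.
    Equality of the moments of order [2m] is drawn from the inequality that involves [s_(2m+2)]. At
    the top order no further inequality is left, whence only [<=] there. *)

Definition seg (f : R -> R) a b : R := Rintegral mu `[a, b] f.

Lemma continuous_seg_integrable (f : R -> R) a b :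
  {within `[a, b], continuous f} -> mu.-integrable `[a, b] (EFin \o f).
Proof. by move=> cf; apply: continuous_compact_integrable => //; exact: segment_compact. Qed.

Lemma seg_cst (k : R) a b : a <= b -> seg (fun=> k) a b = k * (b - a).
Proof.
move=> ab; rewrite /seg Rintegral_cst//= lebesgue_measure_itv/= lte_fin.
by move: ab; rewrite le_eqVlt => /predU1P[->|->] //; rewrite ltxx subrr.
Qed.

Lemma seg_near_cst (f : R -> R) (k e : R) a b : a <= b ->
  {within `[a, b], continuous f} ->
  (forall x, a <= x <= b -> `|f x - k| <= e) ->
  `|seg f a b - k * (b - a)| <= e * (b - a).
Proof.
move=> ab cf fk.
have fi := continuous_seg_integrable cf.
have ci r : mu.-integrable `[a, b] (EFin \o (fun=> r)).
  by apply: continuous_seg_integrable; apply: continuous_subspaceT => ?; exact: cvg_cst.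
rewrite -(seg_cst k ab) -(seg_cst e ab) ler_norml; apply/andP; split.
  rewrite lerBrDr addrC seg_cst// seg_cst// -mulrBl -seg_cst//.
  apply: le_Rintegral => // x /=; rewrite in_itv/= => /fk.
  by rewrite ler_norml => /andP[]; lra.
rewrite lerBlDr seg_cst// seg_cst// -mulrDl -seg_cst//.
apply: le_Rintegral => // x /=; rewrite in_itv/= => /fk.
by rewrite ler_norml => /andP[]; lra.
Qed.

Lemma seg_split (f : R -> R) a b m : a <= m <= b ->
  {within `[a, b], continuous f} -> seg f a b = seg f a m + seg f m b.
Proof.
move=> /andP[am mb] cf; have fi := continuous_seg_integrable cf.
rewrite /seg -[RHS]addrC; apply/eqP; rewrite -subr_eq; apply/eqP.
rewrite Rintegral_itvB ?bnd_simp// Rintegral_itv_obnd_cbnd//.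
by apply: integrableS fi => //; apply: subset_itvr; rewrite bnd_simp.
Qed.

Lemma segD (f g : R -> R) a b :
  {within `[a, b], continuous f} -> {within `[a, b], continuous g} ->
  seg (fun x => f x + g x) a b = seg f a b + seg g a b.
Proof. by move=> cf cg; apply: RintegralD => //; exact: continuous_seg_integrable. Qed.

Definition continuous2_at P x y := forall e : R, 0 < e -> exists2 d : R, 0 < d &
  forall x' y', `|x' - x| < d -> `|y' - y| < d -> `|P x' y' - P x y| <= e.

(* The 1-form is [P dx + Q dy]: closedness at the point means that the partial
   derivatives [P_y] and [Q_x] agree, both being [p2]. *)
Definition closed_form_at P Q x y := exists p1 p2 q2 : R, forall e : R, 0 < e ->
  exists2 d : R, 0 < d & forall x' y', `|x' - x| < d -> `|y' - y| < d ->
    `|P x' y' - P x y - p1 * (x' - x) - p2 * (y' - y)|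
       <= e * (`|x' - x| + `|y' - y|) /\
    `|Q x' y' - Q x y - p2 * (x' - x) - q2 * (y' - y)|
       <= e * (`|x' - x| + `|y' - y|).

Lemma affine_continuous2 P x y p1 p2 : (forall e : R, 0 < e ->
  exists2 d : R, 0 < d & forall x' y', `|x' - x| < d -> `|y' - y| < d ->
    `|P x' y' - P x y - p1 * (x' - x) - p2 * (y' - y)|
       <= e * (`|x' - x| + `|y' - y|)) -> continuous2_at P x y.
Proof.
move=> h e e0; have [d d0 hd] := h 1 ltr01.
pose K : R := `|p1| + `|p2| + 2.
have K0 : 0 < K by rewrite /K ltr_wpDl// addr_ge0.
exists (Num.min d (e / K)); first by rewrite lt_min d0 divr_gt0.
move=> x' y'; rewrite !lt_min => /andP[xd xe] /andP[yd ye].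
have := hd x' y' xd yd; rewrite mul1r => hp.
have -> : P x' y' - P x y = (P x' y' - P x y - p1 * (x' - x) - p2 * (y' - y)) +
  (p1 * (x' - x) + p2 * (y' - y)) by ring.
apply: le_trans (ler_normD _ _) _.
have : `|p1 * (x' - x) + p2 * (y' - y)| <= `|p1| * (e / K) + `|p2| * (e / K).
  apply: le_trans (ler_normD _ _) _; rewrite !normrM.
  by apply: lerD; apply: ler_wpM2l => //; exact: ltW.
have : e = `|p1| * (e / K) + `|p2| * (e / K) + 2 * (e / K).
  by rewrite -!mulrDl -/K mulrCA divff ?mulr1// gt_eqF.
lra.
Qed.

Lemma closed_form_continuous2 P Q x y : closed_form_at P Q x y ->
  continuous2_at P x y /\ continuous2_at Q x y.
Proof.
by move=> [p1 [p2 [q2 h]]]; split; [apply: (@affine_continuous2 P x y p1 p2)|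
  apply: (@affine_continuous2 Q x y p2 q2)] => e e0;
  have [d d0 hd] := h e e0; exists d => // x' y' hx hy; have [] := hd x' y' hx hy.
Qed.

Lemma continuous2_within_h P a b y : (forall x, a <= x <= b -> continuous2_at P x y) ->
  {within `[a, b], continuous (P ^~ y)}.
Proof.
move=> h; apply: continuous_in_subspaceT => x; rewrite inE/= in_itv/= => /h cx.
apply/cvgrPdist_le => e /cx[d d0 hd].
near=> t; rewrite distrC; apply: hd; last by rewrite subrr normr0.
by rewrite distrC; near: t; apply: cvgr_dist_lt.
Unshelve. all: by end_near. Qed.

Lemma continuous2_within_v P c d x : (forall y, c <= y <= d -> continuous2_at P x y) ->
  {within `[c, d], continuous (P x)}.
Proof.
move=> h; apply: continuous_in_subspaceT => y; rewrite inE/= in_itv/= => /h cy.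
apply/cvgrPdist_le => e /cy[r r0 hr].
near=> t; rewrite distrC; apply: hr; first by rewrite subrr normr0.
by rewrite distrC; near: t; apply: cvgr_dist_lt.
Unshelve. all: by end_near. Qed.

(** The counterclockwise circulation of [P dx + Q dy] around the boundary of the rectangle. Opposite
    sides share one integral, so that a bound on the integrand already sees the cancellation of the
    affine part of the form. *)
Definition circ P Q a b c d : R :=
  seg (fun x => P x c - P x d) a b + seg (fun y => Q b y - Q a y) c d.

(** Nested quarters shrink to the point. The ratio [t] records that they are similar to the initial
    rectangle, so that side and area estimates can both be expressed through it. *)
Lemma bisection (Bad : R -> R -> R -> R -> Prop) a b c d :
  a < b -> c < d -> Bad a b c d ->
  (forall a' b' c' d', a <= a' -> a' < b' -> b' <= b ->
     c <= c' -> c' < d' -> d' <= d -> Bad a' b' c' d' ->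
     let m := (a' + b') / 2 in let l := (c' + d') / 2 in
     [\/ Bad a' m c' l, Bad m b' c' l, Bad a' m l d' | Bad m b' l d']) ->
  exists x y, [/\ a <= x <= b, c <= y <= d & forall e : R, 0 < e ->
    exists t a' b' c' d' : R, [/\ [/\ a <= a', a' <= x, x <= b' & b' <= b],
      [/\ c <= c', c' <= y, y <= d' & d' <= d],
      [/\ 0 < t, b' - a' = t * (b - a), d' - c' = t * (d - c) & t < e] &
      Bad a' b' c' d']].
Proof.
move=> ab cd bad0 H.
pose ok (q : (R * R) * (R * R)) := [/\ a <= q.1.1 , q.1.1 < q.1.2, q.1.2 <= b &
   [/\ c <= q.2.1, q.2.1 < q.2.2, q.2.2 <= d & Bad q.1.1 q.1.2 q.2.1 q.2.2]].
(* The step is chosen for every quadruple, and is the identity where [ok] fails; it is thus a total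
   function that can be iterated. *)
have /choice[step stepP] : forall q, exists q', ok q -> [/\ ok q',
    q.1.1 <= q'.1.1 /\ q'.1.2 <= q.1.2,
    q.2.1 <= q'.2.1 /\ q'.2.2 <= q.2.2 &
    q'.1.2 - q'.1.1 = (q.1.2 - q.1.1) / 2 /\
    q'.2.2 - q'.2.1 = (q.2.2 - q.2.1) / 2].
  move=> [[a' b'] [c' d']]; have [[/= h1 h2 h3 [h4 h5 h6 h7]]|no] :=
    pselect (ok ((a', b'), (c', d'))); last by exists ((a', b'), (c', d')).
  case: (H a' b' c' d' h1 h2 h3 h4 h5 h6 h7) => hb.
  - exists ((a', (a' + b') / 2), (c', (c' + d') / 2)) => _.
    by split=> /=; [do 2?split => //=; lra|split; lra|split; lra|split; field].
  - exists (((a' + b') / 2, b'), (c', (c' + d') / 2)) => _.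
    by split=> /=; [do 2?split => //=; lra|split; lra|split; lra|split; field].
  - exists ((a', (a' + b') / 2), ((c' + d') / 2, d')) => _.
    by split=> /=; [do 2?split => //=; lra|split; lra|split; lra|split; field].
  - exists (((a' + b') / 2, b'), ((c' + d') / 2, d')) => _.
    by split=> /=; [do 2?split => //=; lra|split; lra|split; lra|split; field].
pose q n := iter n step ((a, b), (c, d)).
have qok n : ok (q n).
  elim: n => [|n IH]; first by split=> //=; split.
  by rewrite /q iterS; have [] := stepP _ IH.
have qS n : q n.+1 = step (q n) by [].
have qsize n : (q n).1.2 - (q n).1.1 = 2^-1 ^+ n * (b - a) /\
               (q n).2.2 - (q n).2.1 = 2^-1 ^+ n * (d - c).
  elim: n => [|n [IH1 IH2]]; first by rewrite expr0 !mul1r.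
  by rewrite qS; have [_ _ _ [-> ->]] := stepP _ (qok n);
    rewrite IH1 IH2 exprS; split; field.
have qmono n k : [/\ (q n).1.1 <= (q (n + k)%N).1.1, (q (n + k)%N).1.2 <= (q n).1.2,
   (q n).2.1 <= (q (n + k)%N).2.1 & (q (n + k)%N).2.2 <= (q n).2.2].
  elim: k => [|k [i1 i2 i3 i4]]; first by rewrite addn0.
  rewrite addnS qS; have [_ [j1 j2] [j3 j4] _] := stepP _ (qok (n + k)%N).
  by split; lra.
have qcross n m : (q n).1.1 <= (q m).1.2 /\ (q n).2.1 <= (q m).2.2.
  have [h1 _ h3 _] := qmono n m; have [_ h2 _ h4] := qmono m n.
  rewrite addnC in h2 h4; have [_ h5 _ [_ h6 _ _]] := qok (n + m)%N.
  by split; lra.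
pose x := sup (range (fun n => (q n).1.1)); pose y := sup (range (fun n => (q n).2.1)).
have xP n : (q n).1.1 <= x <= (q n).1.2.
  apply/andP; split.
    apply: ub_le_sup; last by exists n.
    by exists (q 0%N).1.2 => _ [m _ <-]; have [] := qcross m 0%N.
  apply: ge_sup; first by exists (q 0%N).1.1; exists 0%N.
  by move=> _ [m _ <-]; have [] := qcross m n.
have yP n : (q n).2.1 <= y <= (q n).2.2.
  apply/andP; split.
    apply: ub_le_sup; last by exists n.
    by exists (q 0%N).2.2 => _ [m _ <-]; have [] := qcross m 0%N.
  apply: ge_sup; first by exists (q 0%N).2.1; exists 0%N.
  by move=> _ [m _ <-]; have [] := qcross m n.
exists x, y; split; [exact: (xP 0%N)|exact: (yP 0%N)|].
move=> e e0.
have [n ne] : exists n, (2^-1 : R) ^+ n < e.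
  have /cvgrPdist_lt/(_ e e0)[n _ /(_ n (leqnn n))] :
    (2^-1 : R) ^+ n @[n --> \oo] --> 0 by apply: cvg_expr; rewrite ger0_norm//; lra.
  rewrite sub0r normrN /= ger0_norm ?exprn_ge0// => hn; by exists n.
exists (2^-1 ^+ n), (q n).1.1, (q n).1.2, (q n).2.1, (q n).2.2.
have [h1 h2 h3 [h4 h5 h6 h7]] := qok n; have [s1 s2] := qsize n.
have /andP[x1 x2] := xP n; have /andP[y1 y2] := yP n.
by split => //; split => //; exact: exprn_gt0.
Qed.

Lemma circ_hsplit P Q a b c d m : a <= m <= b -> c <= d ->
  (forall x y, a <= x <= b -> c <= y <= d -> continuous2_at P x y) ->
  (forall x y, a <= x <= b -> c <= y <= d -> continuous2_at Q x y) ->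
  circ P Q a b c d = circ P Q a m c d + circ P Q m b c d.
Proof.
move=> /andP[am mb] cd cP cQ; rewrite /circ.
have PC y : c <= y <= d -> {within `[a, b], continuous (P ^~ y)}.
  by move=> yy; apply: continuous2_within_h => x xx; apply: cP.
have QC x : a <= x <= b -> {within `[c, d], continuous (Q x)}.
  by move=> xx; apply: continuous2_within_v => y yy; apply: cQ.
have ab := le_trans am mb.
rewrite (@seg_split _ a b m) ?am//; last first.
  by apply: within_continuousB; apply: PC; rewrite lexx ?cd.
have -> : (fun y => Q b y - Q a y) = (fun y => (Q m y - Q a y) + (Q b y - Q m y)).
  by apply/funext => y; ring.
rewrite (@segD (fun y => Q m y - Q a y) (fun y => Q b y - Q m y)); last 2 first.
- by apply: within_continuousB; apply: QC; rewrite ?lexx ?am ?mb ?ab.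
- by apply: within_continuousB; apply: QC; rewrite ?lexx ?am ?mb ?ab.
by ring.
Qed.

Lemma circ_vsplit P Q a b c d l : a <= b -> c <= l <= d ->
  (forall x y, a <= x <= b -> c <= y <= d -> continuous2_at P x y) ->
  (forall x y, a <= x <= b -> c <= y <= d -> continuous2_at Q x y) ->
  circ P Q a b c d = circ P Q a b c l + circ P Q a b l d.
Proof.
move=> ab /andP[cl ld] cP cQ; rewrite /circ.
have PC y : c <= y <= d -> {within `[a, b], continuous (P ^~ y)}.
  by move=> yy; apply: continuous2_within_h => x xx; apply: cP.
have QC x : a <= x <= b -> {within `[c, d], continuous (Q x)}.
  by move=> xx; apply: continuous2_within_v => y yy; apply: cQ.
have cd := le_trans cl ld.
rewrite (@seg_split _ c d l) ?cl//; last first.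
  by apply: within_continuousB; apply: QC; rewrite lexx ?ab.
have -> : (fun x => P x c - P x d) = (fun x => (P x c - P x l) + (P x l - P x d)).
  by apply/funext => y; ring.
rewrite (@segD (fun x => P x c - P x l) (fun x => P x l - P x d)); last 2 first.
- by apply: within_continuousB; apply: PC; rewrite ?lexx ?cl ?ld ?cd.
- by apply: within_continuousB; apply: PC; rewrite ?lexx ?cl ?ld ?cd.
by ring.
Qed.

(** The constants [- p2 (d - c)] and [p2 (b - a)], integrated over the other side, contribute
    opposite amounts; only the deviations from them remain. *)
Lemma circ_bound P Q a b c d (p2 e : R) : a <= b -> c <= d ->
  (forall x y, a <= x <= b -> c <= y <= d -> continuous2_at P x y) ->
  (forall x y, a <= x <= b -> c <= y <= d -> continuous2_at Q x y) ->
  (forall x, a <= x <= b -> `|P x c - P x d + p2 * (d - c)| <= e) ->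
  (forall y, c <= y <= d -> `|Q b y - Q a y - p2 * (b - a)| <= e) ->
  `|circ P Q a b c d| <= e * (b - a + (d - c)).
Proof.
move=> ab cd cP cQ eP eQ; rewrite /circ.
have PC y : c <= y <= d -> {within `[a, b], continuous (P ^~ y)}.
  by move=> yy; apply: continuous2_within_h => x xx; apply: cP.
have QC x : a <= x <= b -> {within `[c, d], continuous (Q x)}.
  by move=> xx; apply: continuous2_within_v => y yy; apply: cQ.
have h1 : `|seg (fun x => P x c - P x d) a b - (- (p2 * (d - c))) * (b - a)| <= e * (b - a).
  apply: seg_near_cst => //; last by move=> x xx; rewrite opprK eP.
  by apply: within_continuousB; apply: PC; rewrite lexx ?cd.
have h2 : `|seg (fun y => Q b y - Q a y) c d - (p2 * (b - a)) * (d - c)| <= e * (d - c).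
  apply: seg_near_cst => //.
  by apply: within_continuousB; apply: QC; rewrite lexx ?ab.
set A := seg _ _ _ in h1 *; set B := seg _ _ _ in h2 *.
have -> : A + B = (A - (- (p2 * (d - c))) * (b - a)) + (B - (p2 * (b - a)) * (d - c)) by ring.
by apply: le_trans (ler_normD _ _) _; rewrite [leRHS]mulrDr; exact: lerD.
Qed.

(** The signed square root, [Num.sqrt] being 0 at negative reals. The product of its increments over
    the two sides is additive under bisection, and for a rectangle that contains the origin it is at
    least the square root of the area, which is of the order of the side. *)
Definition ssqrt (x : R) : R := Num.sqrt x - Num.sqrt (- x).

Lemma ssqrt_homo : {homo ssqrt : x y / x <= y}.
Proof. by move=> x y xy; rewrite /ssqrt lerB// ler_wsqrtr// lerN2. Qed.

Lemma ssqrt_spread x y : x <= 0 -> 0 <= y -> Num.sqrt (y - x) <= ssqrt y - ssqrt x.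
Proof.
move=> x0 y0; rewrite /ssqrt.
have -> : Num.sqrt (- y) = 0 by apply/eqP; rewrite sqrtr_eq0; lra.
have -> : Num.sqrt x = 0 by apply/eqP; rewrite sqrtr_eq0.
rewrite subr0 sub0r opprK.
have h : 0 <= Num.sqrt y + Num.sqrt (- x) by rewrite addr_ge0 ?sqrtr_ge0.
rewrite -(ler_pXn2r (ltn0Sn 1)) ?nnegrE ?sqrtr_ge0//.
rewrite sqr_sqrtr; last by lra.
rewrite sqrrD !sqr_sqrtr ?oppr_ge0//.
have : 0 <= Num.sqrt y * Num.sqrt (- x) by rewrite mulr_ge0 ?sqrtr_ge0.
lra.
Qed.

(** The first-order expansion at the point has an error of order [o(t)], which is integrated over
    sides of length of order [t]; the area is of order [t^2]. *)
Lemma circ_le_area P Q a b c d x y (e : R) :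
  a < b -> c < d -> 0 < e ->
  (forall x y, a <= x <= b -> c <= y <= d -> continuous2_at P x y) ->
  (forall x y, a <= x <= b -> c <= y <= d -> continuous2_at Q x y) ->
  closed_form_at P Q x y ->
  exists2 r : R, 0 < r & forall t a' b' c' d' : R,
    [/\ a <= a', a' <= x, x <= b' & b' <= b] ->
    [/\ c <= c', c' <= y, y <= d' & d' <= d] ->
    [/\ 0 < t, b' - a' = t * (b - a), d' - c' = t * (d - c) & t < r] ->
    `|circ P Q a' b' c' d'| <= e * ((b' - a') * (d' - c')).
Proof.
move=> ab cd e0 cP cQ [p1 [p2 [q2 hpq]]].
pose L : R := (b - a) + (d - c).
have L0 : 0 < L by rewrite /L; lra.
(* The quotient of the area by the squared half-perimeter is common to all similar rectangles; the 3
   absorbs the factor 2 that comes from subtracting opposite sides. *)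
pose e' : R := e * ((b - a) * (d - c)) / (3 * L ^+ 2).
have e'0 : 0 < e'.
  by apply: divr_gt0; [rewrite mulr_gt0// mulr_gt0// subr_gt0|rewrite mulr_gt0// exprn_gt0].
have [r r0 hr] := hpq e' e'0.
exists (r / L); first exact: divr_gt0.
move=> t a' b' c' d' [a1 a2 a3 a4] [c1 c2 c3 c4] [t0 sa sc tr].
have tL : t * L < r by rewrite -ltr_pdivlMr.
have tLE : t * L = (b' - a') + (d' - c') by rewrite /L mulrDr sa sc.
have key X Y : a' <= X <= b' -> c' <= Y <= d' ->
  `|P X Y - P x y - p1 * (X - x) - p2 * (Y - y)| <= e' * (t * L) /\
  `|Q X Y - Q x y - p2 * (X - x) - q2 * (Y - y)| <= e' * (t * L).
  move=> /andP[X1 X2] /andP[Y1 Y2].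
  have hX : `|X - x| <= b' - a' by rewrite ler_norml; lra.
  have hY : `|Y - y| <= d' - c' by rewrite ler_norml; lra.
  have [||] := hr X Y; [by lra|by lra|].
  have : e' * (`|X - x| + `|Y - y|) <= e' * (t * L) by rewrite ler_pM2l//; lra.
  by split; lra.
have : `|circ P Q a' b' c' d'| <= (2 * (e' * (t * L))) * (b' - a' + (d' - c')).
  apply: (@circ_bound _ _ _ _ _ _ p2); [lra|lra| | | |].
  + by move=> X Y hX hY; apply: cP; lra.
  + by move=> X Y hX hY; apply: cQ; lra.
  + move=> X hX; have [k1 _] := key X c' hX ltac:(lra).
    have [k2 _] := key X d' hX ltac:(lra).
    move: k1 k2; rewrite !ler_norml; lra.
  + move=> Y hY; have [_ k1] := key b' Y ltac:(lra) hY.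
    have [_ k2] := key a' Y ltac:(lra) hY.
    move: k1 k2; rewrite !ler_norml; lra.
move=> /le_trans; apply.
rewrite -tLE sa sc /e'.
have -> : 2 * (e * ((b - a) * (d - c)) / (3 * L ^+ 2) * (t * L)) * (t * L) =
   2 / 3 * (e * (t * (b - a) * (t * (d - c)))) by field; exact: lt0r_neq0.
have : 0 < e * (t * (b - a) * (t * (d - c))) by rewrite mulr_gt0// mulr_gt0// mulr_gt0// subr_gt0.
by lra.
Qed.

(** Continuity alone makes opposite sides differ by [o(1)], which is [circ_bound] with [p2 = 0]; one
    factor [t] is left from the length. *)
Lemma circ_le_side P Q a b c d x y (e : R) :
  a < b -> c < d -> 0 < e ->
  (forall x y, a <= x <= b -> c <= y <= d -> continuous2_at P x y) ->
  (forall x y, a <= x <= b -> c <= y <= d -> continuous2_at Q x y) ->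
  continuous2_at P x y -> continuous2_at Q x y ->
  exists2 r : R, 0 < r & forall t a' b' c' d' : R,
    [/\ a <= a', a' <= x, x <= b' & b' <= b] ->
    [/\ c <= c', c' <= y, y <= d' & d' <= d] ->
    [/\ 0 < t, b' - a' = t * (b - a), d' - c' = t * (d - c) & t < r] ->
    `|circ P Q a' b' c' d'| <= e * (t * (Num.sqrt (b - a) * Num.sqrt (d - c))).
Proof.
move=> ab cd e0 cP cQ cPx cQx.
pose L : R := (b - a) + (d - c).
have L0 : 0 < L by rewrite /L; lra.
pose W : R := Num.sqrt (b - a) * Num.sqrt (d - c).
have W0 : 0 < W by rewrite mulr_gt0 ?sqrtr_gt0 ?subr_gt0.
pose e' : R := e * W / (3 * L).
have e'0 : 0 < e' by apply: divr_gt0; rewrite mulr_gt0.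
have [r1 r10 h1] := cPx e' e'0; have [r2 r20 h2] := cQx e' e'0.
exists (Num.min r1 r2 / L); first by rewrite divr_gt0// lt_min r10.
move=> t a' b' c' d' [a1 a2 a3 a4] [c1 c2 c3 c4] [t0 sa sc tr].
have : t * L < Num.min r1 r2 by rewrite -ltr_pdivlMr.
rewrite lt_min => /andP[tL1 tL2].
have tLE : t * L = (b' - a') + (d' - c') by rewrite /L mulrDr sa sc.
have key X Y : a' <= X <= b' -> c' <= Y <= d' ->
  `|P X Y - P x y| <= e' /\ `|Q X Y - Q x y| <= e'.
  move=> /andP[X1 X2] /andP[Y1 Y2].
  have hX : `|X - x| <= b' - a' by rewrite ler_norml; lra.
  have hY : `|Y - y| <= d' - c' by rewrite ler_norml; lra.
  by split; [apply: h1; lra|apply: h2; lra].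
have : `|circ P Q a' b' c' d'| <= (2 * e') * (b' - a' + (d' - c')).
  apply: (@circ_bound _ _ _ _ _ _ 0); [lra|lra| | | |].
  + by move=> X Y hX hY; apply: cP; lra.
  + by move=> X Y hX hY; apply: cQ; lra.
  + move=> X hX; have [k1 _] := key X c' hX ltac:(lra).
    have [k2 _] := key X d' hX ltac:(lra).
    move: k1 k2; rewrite !ler_norml; lra.
  + move=> Y hY; have [_ k1] := key b' Y ltac:(lra) hY.
    have [_ k2] := key a' Y ltac:(lra) hY.
    move: k1 k2; rewrite !ler_norml; lra.
move=> /le_trans; apply.
rewrite -/W -tLE /e'.
have -> : 2 * (e * W / (3 * L)) * (t * L) = 2 / 3 * (e * (t * W)).
  by field; exact: lt0r_neq0.
have : 0 < e * (t * W) by rewrite mulr_gt0// mulr_gt0.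
by lra.
Qed.

(* At the exceptional point the form is only continuous, so the circulation
   around small rectangles is o(side) but not o(area).  Adding to the area the
   additive function [nu], which is at least of the order of the side for
   rectangles containing that point, repairs the bisection argument. *)
Lemma goursat P Q a b c d x0 y0 : a < b -> c < d ->
  (forall x y, a <= x <= b -> c <= y <= d -> closed_form_at P Q x y \/
     [/\ x = x0, y = y0, continuous2_at P x y & continuous2_at Q x y]) ->
  circ P Q a b c d = 0.
Proof.
move=> ab cd H.
have cP x y : a <= x <= b -> c <= y <= d -> continuous2_at P x y.
  by move=> hx hy; have [/closed_form_continuous2[]|[]] := H x y hx hy.
have cQ x y : a <= x <= b -> c <= y <= d -> continuous2_at Q x y.
  by move=> hx hy; have [/closed_form_continuous2[]|[]] := H x y hx hy.
apply/eqP; rewrite -normr_eq0 eq_le normr_ge0 andbT leNgt; apply/negP => I0.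
pose nu a' b' c' d' := (b' - a') * (d' - c') +
  (ssqrt (b' - x0) - ssqrt (a' - x0)) * (ssqrt (d' - y0) - ssqrt (c' - y0)).
have nu_ge a' b' c' d' : a' <= b' -> c' <= d' -> (b' - a') * (d' - c') <= nu a' b' c' d'.
  move=> h1 h2; rewrite /nu lerDl mulr_ge0// subr_ge0 ssqrt_homo//; lra.
have nu0 : 0 < nu a b c d.
  by apply: lt_le_trans (nu_ge _ _ _ _ (ltW ab) (ltW cd)); rewrite mulr_gt0 ?subr_gt0.
(* Half of the ratio, so that the whole rectangle is strictly bad. *)
pose e : R := `|circ P Q a b c d| / (2 * nu a b c d).
have e0 : 0 < e by rewrite divr_gt0// mulr_gt0.
pose Bad a' b' c' d' := e * nu a' b' c' d' < `|circ P Q a' b' c' d'|.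
have bad0 : Bad a b c d.
  rewrite /Bad /e invfM mulrA -!mulrA mulVf ?gt_eqF// mulr1; lra.
have [|x [y [xab ycd Hxy]]] := bisection (Bad := Bad) ab cd bad0.
  move=> a' b' c' d' aa ab' bb cc cd' dd B m l; rewrite /Bad in B.
  have am : a' <= m <= b' by rewrite /m; lra.
  have cl : c' <= l <= d' by rewrite /l; lra.
  have {}cP X Y : a' <= X <= b' -> c' <= Y <= d' -> continuous2_at P X Y.
    by move=> hX hY; apply: cP; lra.
  have {}cQ X Y : a' <= X <= b' -> c' <= Y <= d' -> continuous2_at Q X Y.
    by move=> hX hY; apply: cQ; lra.
  move: B; rewrite (circ_hsplit am) ?(ltW cd')//.
  rewrite (@circ_vsplit P Q a' m c' d' l)//; last 3 first.
  - by lra.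
  - by move=> X Y hX hY; apply: cP; lra.
  - by move=> X Y hX hY; apply: cQ; lra.
  rewrite (@circ_vsplit P Q m b' c' d' l)//; last 3 first.
  - by lra.
  - by move=> X Y hX hY; apply: cP; lra.
  - by move=> X Y hX hY; apply: cQ; lra.
  set I1 := circ _ _ a' m c' l; set I2 := circ _ _ a' m l d'.
  set I3 := circ _ _ m b' c' l; set I4 := circ _ _ m b' l d'.
  have -> : nu a' b' c' d' = nu a' m c' l + nu a' m l d' + nu m b' c' l + nu m b' l d'.
    by rewrite /nu; ring.
  move=> B.
  case: (ltP (e * nu a' m c' l) `|I1|) => h1; first by constructor 1.
  case: (ltP (e * nu m b' c' l) `|I3|) => h2; first by constructor 2.
  case: (ltP (e * nu a' m l d') `|I2|) => h3; first by constructor 3.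
  constructor 4; rewrite /Bad ltNge; apply/negP => h4.
  rewrite -/I4 in h4.
  have : `|I1 + I2 + (I3 + I4)| <= `|I1| + `|I2| + (`|I3| + `|I4|).
    by apply: le_trans (ler_normD _ _) _; apply: lerD; exact: ler_normD.
  by move: B h1 h2 h3 h4; rewrite !mulrDr; clearbody I1 I2 I3 I4; lra.
have e20 : 0 < e / 2 by lra.
(* At an ordinary point the area term of [nu] gives the contradiction, at the exceptional point its
   square-root term does. *)
have [hpq|[xx yy cPx cQx]] := H x y xab ycd.
- have [r r0 hr] := circ_le_area ab cd e20 cP cQ hpq.
  have [t [a' [b' [c' [d' [h1 h2 h3 B]]]]]] := Hxy r r0.
  have := hr t a' b' c' d' h1 h2 h3; apply/negP; rewrite -ltNge.
  apply: le_lt_trans B; move: h1 h2 => [_ h11 h12 _] [_ h21 h22 _].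
  have := nu_ge a' b' c' d' (le_trans h11 h12) (le_trans h21 h22).
  rewrite -(ler_pM2l e20) => /le_trans; apply.
  have : 0 <= nu a' b' c' d'.
    by apply: le_trans (nu_ge _ _ _ _ _ _); rewrite ?mulr_ge0 ?subr_ge0//; lra.
  by move=> h; apply: ler_wpM2r => //; lra.
- have [r r0 hr] := circ_le_side ab cd e20 cP cQ cPx cQx.
  have [t [a' [b' [c' [d' [h1 h2 h3 B]]]]]] := Hxy r r0.
  have := hr t a' b' c' d' h1 h2 h3; apply/negP; rewrite -ltNge.
  apply: le_lt_trans B; move: h1 h2 => [_ h11 h12 _] [_ h21 h22 _].
  move: h3 => [t0 sa sc _].
  apply: ler_pM => //; [exact: ltW| |by lra|].
    by rewrite !mulr_ge0 ?sqrtr_ge0 ?(ltW t0).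
  have -> : t * (Num.sqrt (b - a) * Num.sqrt (d - c)) = Num.sqrt (b' - a') * Num.sqrt (d' - c').
    by rewrite sa sc !sqrtrM ?(ltW t0)// mulrACA -expr2 sqr_sqrtr ?(ltW t0).
  rewrite /nu -[leLHS]add0r lerD//; first by rewrite mulr_ge0//; lra.
  apply: ler_pM; rewrite ?sqrtr_ge0//.
    have -> : b' - a' = (b' - x0) - (a' - x0) by ring.
    by apply: ssqrt_spread; lra.
  have -> : d' - c' = (d' - y0) - (c' - y0) by ring.
  by apply: ssqrt_spread; lra.
Qed.

End Goursat.

(** * Complex differentiability and closed forms *)

Section ComplexDifferentiability.
Context {R : realType}.
Local Notation C := (R[i]).
Local Notation normc := Normc.normc.
Implicit Types (z h : C) (F G : C -> C).

(** The norm of [R[i]] takes its values in [R[i]]; estimates are carried over to the real-valued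
    [normc], where real arithmetic applies. *)
Lemma normrcE z : `|z| = (normc z)%:C. Proof. by case: z. Qed.

Lemma ltcRE (z : C) (r : R) : (`|z| < r%:C) = (normc z < r).
Proof. by rewrite normrcE ltcR. Qed.

Lemma lecRE (z : C) (r : R) : (`|z| <= r%:C) = (normc z <= r).
Proof. by rewrite normrcE lecR. Qed.

Lemma normc_ge0 z : 0 <= normc z.
Proof. by case: z => a b; exact: sqrtr_ge0. Qed.

Lemma normc_gt0 z : (0 < normc z) = (z != 0).
Proof. by rewrite -ltcR -normrcE normr_gt0. Qed.

Lemma normc_real (r : R) : normc r%:C = `|r|.
Proof. by rewrite /= expr0n/= addr0 sqrtr_sqr. Qed.

Lemma normc_Re z : `|complex.Re z| <= normc z.
Proof. by rewrite -lecR -normrcE normc_ge_Re. Qed.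

Lemma normc_Im z : `|complex.Im z| <= normc z.
Proof.
case: z => a b /=; rewrite -(sqrtr_sqr b) ler_wsqrtr// lerDr sqr_ge0//.
Qed.

Lemma normc_le z : normc z <= `|complex.Re z| + `|complex.Im z|.
Proof.
case: z => a b /=; rewrite -(ler_pXn2r (ltn0Sn 1)) ?nnegrE ?sqrtr_ge0 ?addr_ge0//.
rewrite sqr_sqrtr ?addr_ge0 ?sqr_ge0// sqrrD !real_normK ?num_real//.
rewrite addrAC lerDl mulrn_wge0// mulr_ge0//.
Qed.

Lemma normc_sqr z : normc z ^+ 2 = complex.Re z ^+ 2 + complex.Im z ^+ 2.
Proof. by case: z => a b /=; rewrite sqr_sqrtr// addr_ge0 ?sqr_ge0. Qed.

Lemma ReB z h : complex.Re (z - h) = complex.Re z - complex.Re h.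
Proof. by case: z; case: h. Qed.
Lemma ImB z h : complex.Im (z - h) = complex.Im z - complex.Im h.
Proof. by case: z; case: h. Qed.
Lemma ReM z h : complex.Re (z * h) = complex.Re z * complex.Re h - complex.Im z * complex.Im h.
Proof. by case: z; case: h. Qed.
Lemma ImM z h : complex.Im (z * h) = complex.Re z * complex.Im h + complex.Im z * complex.Re h.
Proof. by case: z => a b; case: h => c d /=; rewrite addrC. Qed.

(** A first-order expansion with a real-valued norm, from which those of the real and imaginary
    parts are read off; the increment 0 is allowed. *)
Definition cdiff F z (D : C) := forall e : R, 0 < e -> exists2 d : R, 0 < d &
  forall h, normc h < d -> normc (F (z + h) - F z - D * h) <= e * normc h.

Lemma derivable_cdiff F z : derivable (F : C^o -> C^o) z 1 -> exists D, cdiff F z D.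
Proof.
move=> /cvgrPdist_le h; set D := lim _ in h.
exists D => e e0.
have ec0 : 0 < e%:C :> C by rewrite ltcR.
have /nbhs_ballP[d /= d0 hd] := h _ ec0.
have dR : d = (complex.Re d)%:C by rewrite RRe_real// gtr0_real.
exists (complex.Re d); first by rewrite -ltcR -dR.
move=> k kd; have [->|k0] := eqVneq k 0.
  by rewrite addr0 subrr mulr0 subrr Normc.normc0 mulr0.
have : `|D - k^-1 *: ((F \o shift z) (k *: 1) - F z)| <= e%:C.
  apply: hd => //; rewrite -ball_normE /= sub0r normrN dR ltcRE//.
rewrite lecRE /= => {}hd.
have -> : F (z + k) - F z - D * k =
   - ((D - k^-1 *: (F (k *: 1 + z) - F z)) * k).
  rewrite /GRing.scale/= mulr1 (addrC k z); field; exact: k0.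
by rewrite normcN Normc.normcM ler_wpM2r// normc_ge0.
Qed.

Lemma cdiffB F G z D E : cdiff F z D -> cdiff G z E ->
  cdiff (fun t => F t - G t) z (D - E).
Proof.
move=> hF hG e e0; have e20 : 0 < e / 2 by lra.
have [d d0 hd] := hF _ e20; have [r r0 hr] := hG _ e20.
exists (Num.min d r); first by rewrite lt_min d0.
move=> h; rewrite lt_min => /andP[/hd h1 /hr h2].
have -> : F (z + h) - G (z + h) - (F z - G z) - (D - E) * h =
  (F (z + h) - F z - D * h) - (G (z + h) - G z - E * h) by ring.
apply: le_trans (le_normcD _ _) _; rewrite normcN; lra.
Qed.

(** For [F = u + iv] this is the form [Im (F dz) = v dx + u dy]. By the Cauchy-Riemann equations
    [v_y] and [u_x] are both [Re D]. *)
Lemma cdiff_closed_form F z D : cdiff F z D ->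
  closed_form_at (fun x y => complex.Im (F (x +i* y)))
    (fun x y => complex.Re (F (x +i* y))) (complex.Re z) (complex.Im z).
Proof.
move=> hF; exists (complex.Im D), (complex.Re D), (- complex.Im D) => e e0.
have [d d0 hd] := hF e e0; exists (d / 2); first by lra.
move=> x y hx hy; pose h : C := (x - complex.Re z) +i* (y - complex.Im z).
have hE : z + h = x +i* y.
  by rewrite /h; case: (z) => a b; congr (_ +i* _); rewrite /= addrC subrK.
have hn : normc h <= `|x - complex.Re z| + `|y - complex.Im z| := normc_le h.
have zE : complex.Re z +i* complex.Im z = z by case: (z).
have hh := hd h (ltac:(lra)).
have {}hh : normc (F (z + h) - F z - D * h) <= e * (`|x - complex.Re z| + `|y - complex.Im z|).
  by apply: le_trans hh _; rewrite ler_pM2l.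
rewrite hE in hh; rewrite zE; split.
- apply: le_trans hh; apply: le_trans (normc_Im _).
  rewrite !ImB ImM /h/= le_eqVlt; apply/orP; left; apply/eqP; congr `|_|; ring.
- apply: le_trans hh; apply: le_trans (normc_Re _).
  rewrite !ReB ReM /h/= le_eqVlt; apply/orP; left; apply/eqP; congr `|_|; ring.
Qed.

End ComplexDifferentiability.

(** * The Poisson kernel of the upper half-plane *)

Section PoissonKernel.
Context {R : realType}.
Implicit Types x y t a b : R.

(** This is [Im (t - z)^-1] at [z = x + iy], that is, the Poisson kernel without its factor
    [1 / pi]; hence the [pi] in the formulas below. *)
Definition poisson x y t : R := y / ((t - x) ^+ 2 + y ^+ 2).

Lemma poisson_den_gt0 x y t : 0 < y -> 0 < (t - x) ^+ 2 + y ^+ 2.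
Proof. by move=> y0; rewrite ltr_wpDl ?sqr_ge0// exprn_gt0. Qed.

Lemma poisson_gt0 x y t : 0 < y -> 0 < poisson x y t.
Proof. by move=> y0; rewrite divr_gt0// poisson_den_gt0. Qed.

Lemma poisson_sym x y t : poisson x y t = poisson t y x.
Proof. by rewrite /poisson -opprB sqrrN. Qed.

Lemma poisson_le x y t : 0 < y -> poisson x y t <= y^-1.
Proof.
move=> y0; rewrite /poisson ler_pdivrMr ?poisson_den_gt0//.
rewrite mulrDr expr2 (expr2 y) mulKf ?gt_eqF// ler_wpDl// mulr_ge0// ?invr_ge0 ?(ltW y0)//.
by rewrite -expr2 sqr_ge0.
Qed.

Lemma continuous_poisson x y : 0 < y -> continuous (poisson x y).
Proof.
move=> y0 t; apply: cvgM; first exact: cvg_cst.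
apply: cvgV; first by rewrite gt_eqF ?poisson_den_gt0.
apply: cvgD; last exact: cvg_cst.
by apply: cvgM; apply: cvgB; [exact: cvg_id|exact: cvg_cst|exact: cvg_id|exact: cvg_cst].
Qed.

Lemma is_derive_atan_poisson x y t : 0 < y ->
  is_derive t 1 (fun t => atan ((t - x) / y)) (poisson x y t).
Proof.
move=> y0.
have h : is_derive t 1 (fun t : R => (t - x) / y) y^-1.
  have -> : (fun t : R => (t - x) / y) = y^-1 \*: (fun t => t - x).
    by apply/funext => s; rewrite mulrC.
  by apply: is_derive_eq; rewrite subr0 /GRing.scale/= mulr1.
have := @is_derive1_comp _ atan (fun t => (t - x) / y) t _ _ (is_derive1_atan _) h.
congr is_derive; rewrite /poisson; field.
by rewrite !gt_eqF// poisson_den_gt0.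
Qed.

Lemma seg_poisson x y a b : 0 < y -> a < b ->
  seg (poisson x y) a b = atan ((b - x) / y) - atan ((a - x) / y).
Proof.
move=> y0 ab; rewrite /seg /Rintegral.
have cF : continuous (fun t => atan ((t - x) / y)).
  by move=> t; apply/differentiable_continuous/derivable1_diffP;
     have [] := is_derive_atan_poisson x t y0.
rewrite (@continuous_FTC2 _ _ (fun t => atan ((t - x) / y)))//=.
- by apply: continuous_subspaceT; exact: continuous_poisson.
- split.
  + by move=> t _; have [] := is_derive_atan_poisson x t y0.
  + exact/cvg_at_right_filter/cF.
  + exact/cvg_at_left_filter/cF.
- move=> t _; rewrite derive1E; apply: derive_val.
  exact: is_derive_atan_poisson.
Qed.

End PoissonKernel.

(** * The Poisson formula *)

Section PoissonFormula.
Context {R : realType}.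
Local Notation C := (R[i]).
Local Notation normc := Normc.normc.
Variables (f : C -> C) (e M : R).
Hypothesis e0 : 0 < e.
Hypothesis fdiff : forall z : C, - e < complex.Im z -> derivable (f : C^o -> C^o) z 1.
Hypothesis fM : forall z : C, 0 <= complex.Im z -> normc (f z) <= M.
Variables (x y : R).
Hypothesis y0 : 0 < y.
Let z : C := x +i* y.
Let zb : C := x -i* y.
Variable D : C.
Hypothesis fD : cdiff f z D.

(* On the real line [y (t - z)^-1 (t - zb)^-1] is the Poisson kernel; the
   singularity at [z] is removed by subtracting [f z]. *)
Let F0 (t : C) : C := (f t - f z) * (t - z)^-1 * (y%:C * (t - zb)^-1).
Let F (t : C) : C := if t == z then D * (y%:C * (z - zb)^-1) else F0 t.

Let sub_zb_ge (t : C) : 0 <= complex.Im t -> y <= normc (t - zb).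
Proof.
move=> t0; apply: le_trans (normc_Im _); rewrite ImB /= opprK.
by apply: le_trans (ler_norm _); lra.
Qed.

Let sub_zb_neq0 (t : C) : 0 <= complex.Im t -> t - zb != 0.
Proof. by move=> /sub_zb_ge h; rewrite -normc_gt0 (lt_le_trans y0). Qed.

Let F0_diff (t : C) : 0 <= complex.Im t -> t != z -> derivable (F0 : C^o -> C^o) t 1.
Proof.
move=> t0 tz.
have df : derivable (f : C^o -> C^o) t 1 by apply: fdiff; have := e0; lra.
have dl (c : C) : derivable ((fun s => s - c) : C^o -> C^o) t 1.
  by apply: derivableB; [exact: derivable_id|exact: derivable_cst].
apply: (@derivableM _ C^o (fun t : C^o => (f t - f z) * (t - z)^-1) (fun t : C^o => y%:C * (t - zb)^-1)).
  apply: (@derivableM _ C^o (fun t : C^o => f t - f z) (fun t : C^o => (t - z)^-1)).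
    by apply: derivableB; [exact: df|exact: derivable_cst].
  by apply: derivableV; [rewrite subr_eq0|exact: dl].
apply: (@derivableM _ C^o (fun=> y%:C) (fun t : C^o => (t - zb)^-1)).
  exact: derivable_cst.
by apply: derivableV; [exact: sub_zb_neq0|exact: dl].
Qed.

Let F_cdiff (t : C) : 0 <= complex.Im t -> t != z -> exists E, cdiff F t E.
Proof.
move=> t0 tz; have [E hE] := derivable_cdiff (F0_diff t0 tz).
exists E => r r0; have [d d0 hd] := hE r r0.
exists (Num.min d (normc (t - z))).
  by rewrite lt_min d0 normc_gt0 subr_eq0.
move=> h; rewrite lt_min => /andP[hh ht].
have tz' : t + h != z.
  apply/eqP => tz'; move: ht; rewrite -tz'.
  by rewrite opprD addrA subrr sub0r normcN ltxx.
by rewrite /F (negbTE tz) (negbTE tz'); exact: hd.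
Qed.

Let kb (t : C) : C := y%:C * (t - zb)^-1.

Let kb_le1 (t : C) : 0 <= complex.Im t -> normc (kb t) <= 1.
Proof.
move=> t0; rewrite /kb Normc.normcM Normc.normcV normc_real gtr0_norm//.
by rewrite ler_pdivrMr ?mul1r ?sub_zb_ge// (lt_le_trans y0)// sub_zb_ge.
Qed.

Let kb_lip (t : C) : 0 <= complex.Im t -> normc (kb t - kb z) <= normc (t - z) / y.
Proof.
move=> t0; have z0 : 0 <= complex.Im z by exact: ltW.
have -> : kb t - kb z = - (kb t * (t - z) * (z - zb)^-1).
  by rewrite /kb; field; rewrite !sub_zb_neq0.
rewrite normcN (Normc.normcM (kb t * _)) (Normc.normcM (kb t)) Normc.normcV -mulrA.
have h1 := kb_le1 t0; have h2 := sub_zb_ge z0.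
rewrite -[leRHS]mul1r; apply: ler_pM => //; rewrite ?normc_ge0//.
  by rewrite mulr_ge0 ?invr_ge0 ?normc_ge0.
by rewrite ler_wpM2l ?normc_ge0// lef_pV2// posrE (lt_le_trans y0).
Qed.

Let F_cont (r : R) : 0 < r -> exists2 d : R, 0 < d & forall h, normc h < d -> normc (F (z + h) - F z) <= r.
Proof.
move=> r0; pose r' := r / 2; have r'0 : 0 < r' by rewrite /r'; lra.
have [d d0 hd] := fD r'0.
pose K : R := normc D + 1; have K0 : 0 < K by rewrite /K ltr_wpDl ?normc_ge0.
(* The bound [y] keeps [z + h] in the closed half-plane; the last bound makes [normc D] times the
   variation of [kb] at most [r']. *)
exists (Num.min d (Num.min y (r' * y / K))).
  by rewrite !lt_min d0 y0 divr_gt0// mulr_gt0.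
move=> h; rewrite !lt_min => /and3P[h1 h2 h3].
have [->|hn0] := eqVneq h 0; first by rewrite addr0 subrr Normc.normc0 ltW.
have nz : z + h == z = false by apply/negbTE; rewrite -subr_eq0 addrC addKr.
have zh0 : 0 <= complex.Im (z + h).
  have := normc_Im h; rewrite raddfD /= ler_norml => /andP[]; lra.
rewrite /F eqxx nz /F0.
set q := (f (z + h) - f z) * _.
have qD : normc (q - D) <= r'.
  rewrite -(ler_pM2r (_ : 0 < normc h)) ?normc_gt0// -Normc.normcM.
  apply: le_trans (hd h h1); rewrite le_eqVlt; apply/orP; left; apply/eqP.
  congr (normc _); rewrite /q (_ : z + h - z = h); last by rewrite addrC addKr.
  by field.
rewrite -/(kb (z + h)) -/(kb z).
have -> : q * kb (z + h) - D * kb z = (q - D) * kb (z + h) + D * (kb (z + h) - kb z) by ring.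
apply: le_trans (le_normcD _ _) _.
rewrite (Normc.normcM (q - D) (kb _)) (Normc.normcM D (kb _ - _)).
have k1 := kb_le1 zh0; have k2 := kb_lip zh0.
have e1 : normc (q - D) * normc (kb (z + h)) <= r' * 1.
  by apply: ler_pM; rewrite ?normc_ge0.
have e2 : normc D * normc (kb (z + h) - kb z) <= K * (r' / K).
  apply: ler_pM; rewrite ?normc_ge0//; first by rewrite /K lerDl.
  apply: le_trans k2 _; rewrite (_ : z + h - z = h); last by rewrite addrC addKr.
  by rewrite ler_pdivrMr// mulrAC ltW.
have : K * (r' / K) = r' by field; exact: lt0r_neq0.
by move: e1 e2; rewrite /r'; lra.
Qed.

Let P X Y := complex.Im (F (X +i* Y)).
Let Q X Y := complex.Re (F (X +i* Y)).

Let PQ_closed X Y : 0 <= Y -> closed_form_at P Q X Y \/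
  [/\ X = x, Y = y, continuous2_at P X Y & continuous2_at Q X Y].
Proof.
move=> Y0; have [hz|hz] := eqVneq (X +i* Y) z; last first.
  by left; have [E /cdiff_closed_form] := F_cdiff (t := X +i* Y) Y0 hz.
right; have [-> ->] : X = x /\ Y = y by case: hz.
have h (r : R) : 0 < r -> exists2 d : R, 0 < d & forall x' y',
  `|x' - x| < d -> `|y' - y| < d -> normc (F (x' +i* y') - F z) <= r.
  move=> /F_cont[d d0 hd]; exists (d / 2); first by lra.
  move=> x' y' hx hy; have -> : x' +i* y' = z + ((x' - x) +i* (y' - y)).
    by rewrite /z; congr (_ +i* _); rewrite /= addrC subrK.
  by apply: hd; apply: le_lt_trans (normc_le _) _ => /=; lra.
split=> // r /h[d d0 hd]; exists d => // x' y' hx hy; apply: le_trans (hd _ _ hx hy).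
  by rewrite /P -ImB normc_Im.
by rewrite /Q -ReB normc_Re.
Qed.

(** Each of the two poles contributes a factor [1 / r]. Sides of length [O(r)] therefore contribute
    [O(1 / r)] to the circulation. *)
Let F_bound (r : R) (t : C) : 0 < r -> 0 <= complex.Im t ->
  r <= normc (t - z) -> r <= normc (t - zb) ->  normc (F t) <= 2 * M * y / r ^+ 2.
Proof.
move=> r0 t0 h1 h2; have n1 := lt_le_trans r0 h1; have n2 := lt_le_trans r0 h2.
rewrite /F ifF; last by apply/negbTE; rewrite -subr_eq0 -normc_gt0.
rewrite /F0 !Normc.normcM !Normc.normcV normc_real gtr0_norm//.
have -> : 2 * M * y / r ^+ 2 = (2 * M) * r^-1 * (y * r^-1).
  by field; exact: lt0r_neq0.
apply: ler_pM; rewrite ?mulr_ge0 ?invr_ge0 ?normc_ge0 ?(ltW y0)//.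
  apply: ler_pM; rewrite ?invr_ge0 ?normc_ge0//.
    apply: le_trans (le_normcD _ _) _; rewrite normcN.
    have := fM t0; have := fM (z := z) (ltW y0); lra.
  by rewrite lef_pV2 ?posrE.
by rewrite ler_wpM2l ?(ltW y0)// lef_pV2 ?posrE.
Qed.

(** Cauchy's theorem for [F] on the rectangle [[-r, r] x [0, r]]: the bottom side carries the
    Poisson integrand, and the other three sides are small. *)
Lemma poisson_formula_trunc (r : R) : 2 * (`|x| + y) < r ->
  `|seg (fun t => (complex.Im (f t%:C) - complex.Im (f z)) * poisson x y t) (- r) r|
    <= 32 * M * y / r.
Proof.
move=> rb; have r0 : 0 < r by apply: le_lt_trans rb; rewrite mulr_ge0// addr_ge0// ltW.
have nx : `|x| < r / 2 by have := y0; lra.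
have ny : y < r / 2 by have := normr_ge0 x; lra.
have /andP[x1 x2] : - (r / 2) < x < r / 2 by rewrite -ltr_norml.
have cl X Y : - r <= X <= r -> 0 <= Y <= r -> closed_form_at P Q X Y \/
  [/\ X = x, Y = y, continuous2_at P X Y & continuous2_at Q X Y].
  by move=> _ /andP[Y0 _]; exact: PQ_closed.
have rr : - r < r by lra.
have := goursat rr r0 cl; rewrite /circ.
have cP X Y : 0 <= Y -> continuous2_at P X Y.
  by move=> /(PQ_closed X)[/closed_form_continuous2[]|[]].
have cQ X Y : 0 <= Y -> continuous2_at Q X Y.
  by move=> /(PQ_closed X)[/closed_form_continuous2[]|[]].
have wP Y : 0 <= Y -> {within `[- r, r], continuous (P ^~ Y)}.
  by move=> Y0; apply: continuous2_within_h => X _; exact: cP.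
have wQ X : {within `[0, r], continuous (Q X)}.
  by apply: continuous2_within_v => Y /andP[Y0 _]; exact: cQ.
(* The three remote sides stay at distance at least [r / 2] from [z] and its conjugate. The top
   contributes at most [2 r B] and the vertical sides also [2 r B], which add up to [32 M y / r]. *)
pose B : R := 2 * M * y / (r / 2) ^+ 2.
have r20 : 0 < r / 2 by lra.
have bd X Y : 0 <= Y -> [\/ X = r, X = - r | Y = r] -> normc (F (X +i* Y)) <= B.
  move=> Y0 h; apply: F_bound => //.
  - case: h => ->; [apply: le_trans (normc_Re _)|apply: le_trans (normc_Re _)|
      apply: le_trans (normc_Im _)]; rewrite ?ReB ?ImB/=.
    + by apply: le_trans (ler_norm _); have := y0; lra.
    + by rewrite -normrN; apply: le_trans (ler_norm _); lra.
    + by apply: le_trans (ler_norm _); have := y0; lra.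
  - case: h => ->; [apply: le_trans (normc_Re _)|apply: le_trans (normc_Re _)|
      apply: le_trans (normc_Im _)]; rewrite ?ReB ?ImB/=.
    + by apply: le_trans (ler_norm _); have := y0; lra.
    + by rewrite -normrN; apply: le_trans (ler_norm _); lra.
    + by apply: le_trans (ler_norm _); have := y0; lra.
have split1 : seg (fun t => P t 0 - P t r) (- r) r = seg (P ^~ 0) (- r) r + seg (fun t => - P t r) (- r) r.
  apply: segD; first exact: wP.
  by move=> t; apply: cvgN; exact: (wP r (ltW r0)).
have b1 : `|seg (fun t => - P t r) (- r) r - 0 * (r - - r)| <= B * (r - - r).
  apply: seg_near_cst; first exact: ltW.
    by move=> t; apply: cvgN; exact: (wP r (ltW r0)).
  by move=> t _; rewrite subr0 normrN; apply: le_trans (normc_Im _) _; apply: bd; [exact: ltW|constructor 3].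
have b2 : `|seg (fun t => Q r t - Q (- r) t) 0 r - 0 * (r - 0)| <= (2 * B) * (r - 0).
  apply: seg_near_cst; first exact: ltW.
    by apply: within_continuousB.
  move=> t /andP[t0 _]; rewrite subr0; apply: le_trans (ler_normB _ _) _.
  have := bd r t t0 (ltac:(by constructor 1)); have := bd (- r) t t0 (ltac:(by constructor 2)).
  have := normc_Re (F (r +i* t)); have := normc_Re (F ((- r) +i* t)).
  by rewrite /Q; lra.
have -> : seg (fun t => (complex.Im (f t%:C) - complex.Im (f z)) * poisson x y t) (- r) r
  = seg (P ^~ 0) (- r) r.
  congr (seg _ _ _); apply/funext => t; rewrite /P /F ifF; last first.
    by apply/negbTE/eqP => -[_ yy]; move: y0; rewrite -yy ltxx.
  have -> : F0 (t +i* 0) = (f t%:C - f z) * (poisson x y t)%:C.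
    rewrite -[t +i* 0]/(t%:C) /F0 -mulrA; congr (_ * _).
    have p0 := poisson_den_gt0 x t y0.
    have t1 : t%:C - z != 0.
      by apply/eqP => -[_ yy]; move: y0; rewrite -oppr_lt0 -yy ?sub0r; lra.
    have t2 : t%:C - zb != 0 by apply: sub_zb_neq0.
    apply: (mulfI t1); apply: (mulIf t2).
    have -> : (t%:C - z) * ((t%:C - z)^-1 * (y%:C / (t%:C - zb))) * (t%:C - zb) = y%:C.
      by field; rewrite t1 t2.
    apply/eqP; rewrite eq_complex /poisson /=; apply/andP; split; apply/eqP; field; exact: lt0r_neq0.
  by rewrite ImM ImB /=; ring.
rewrite split1 => h0.
have -> : seg (P ^~ 0) (- r) r = - (seg (fun t => - P t r) (- r) r - 0 * (r - - r)) -
    (seg (fun t => Q r t - Q (- r) t) 0 r - 0 * (r - 0)) by lra.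
apply: le_trans (ler_normB _ _) _; rewrite normrN.
apply: le_trans (lerD b1 b2) _; rewrite /B le_eqVlt; apply/orP; left; apply/eqP.
by field; exact: lt0r_neq0.
Qed.

End PoissonFormula.

(** * Removing a cut-off weight by monotone convergence *)

Section PoissonCutoff.
Context {R : realType}.
Variable m : {measure set (measurableTypeR R) -> \bar R}.

(** The weight [N^2 / (t^2 + N^2)] increases to 1. It equals [N] times the Poisson kernel of [iN],
    so that information on the imaginary axis bounds the weighted integrals, and hence masses and
    moments. *)
Lemma integral_le_of_cutoff (h : R -> R) (c : R) :
  measurable_fun [set: measurableTypeR R] h -> (forall t : R, 0 <= h t) ->
  (forall n : nat,
    (\int[m]_t (h t * (n.+1%:R ^+ 2 / (t ^+ 2 + n.+1%:R ^+ 2)))%:E <= c%:E)%E) ->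
  (\int[m]_t (h t)%:E <= c%:E)%E.
Proof.
move=> mh h0 hc.
pose g (n : nat) (t : measurableTypeR R) := (h t * (n.+1%:R ^+ 2 / (t ^+ 2 + n.+1%:R ^+ 2)))%:E.
have d (t : R) k : 0 < t ^+ 2 + k.+1%:R ^+ 2 by rewrite ltr_wpDl ?sqr_ge0 ?exprn_gt0.
have g_ge0 n t : (0 <= g n t)%E by rewrite lee_fin mulr_ge0// divr_ge0 ?sqr_ge0 ?ltW.
have mg n : measurable_fun setT (g n).
  apply/measurable_EFinP/measurable_funM => //.
  apply: (continuous_measurable_fun (f := fun t : R => n.+1%:R ^+ 2 / (t ^+ 2 + n.+1%:R ^+ 2))) => t.
  apply: cvgM; first exact: cvg_cst.
  apply: cvgV; first by rewrite gt_eqF.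
  apply: cvgD; last exact: cvg_cst.
  by apply: cvgM; exact: cvg_id.
have hom t : {homo g ^~ t : n m / (n <= m)%N >-> (n <= m)%E}.
  move=> n k nk; rewrite lee_fin ler_wpM2l//.
  rewrite ler_pdivrMr// mulrAC ler_pdivlMr// !mulrDr mulrC lerD//; last by rewrite mulrC.
  by rewrite mulrC ler_wpM2r ?sqr_ge0// ler_sqr ?nnegrE// ler_nat.
have lim_g t : limn (g ^~ t) = (h t)%:E.
  apply/cvg_lim => //; apply/cvg_EFin; first exact: nearW.
  rewrite -[X in _ --> X]mulr1; apply: cvgM; first exact: cvg_cst.
  have -> : (fun n : nat => n.+1%:R ^+ 2 / (t ^+ 2 + n.+1%:R ^+ 2) : R) =
     (fun n : nat => 1 - t ^+ 2 * (t ^+ 2 + n.+1%:R ^+ 2)^-1).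
    apply/funext => n; have := d t n.
    by move: (n.+1%:R : R) => N dn; field; exact: lt0r_neq0.
  rewrite -[X in _ --> X](subr0 1); apply: cvgB; first exact: cvg_cst.
  rewrite -(mulr0 (t ^+ 2)); apply: cvgM; first exact: cvg_cst.
  apply/gtr0_cvgV0; first by near=> n.
  apply/cvgryPge => A; near=> n.
  have hA : A <= n%:R by near: n; exact: nbhs_infty_ger.
  have : (n%:R : R) <= n.+1%:R ^+ 2.
    by rewrite -natrX ler_nat (leq_trans (leqnSn n))// leq_pmulr.
  have := sqr_ge0 t; lra.
have := @cvg_monotone_convergence _ _ _ m setT measurableT g mg
  (fun n t _ => g_ge0 n t) (fun t _ => hom t).
under eq_integral do rewrite lim_g.
by move=> cg; apply: (cvge_le _ cg) => //; apply: nearW => n; exact: hc.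
Unshelve. all: by end_near. Qed.

End PoissonCutoff.

(** * The Poisson formula on the whole line *)

Section PoissonFormulaLine.
Context {R : realType}.
Local Notation C := (R[i]).
Local Notation normc := Normc.normc.
Local Notation mu := (@lebesgue_measure R).
Variables (f : C -> C) (e M : R).
Hypothesis e0 : 0 < e.
Hypothesis fdiff : forall z : C, - e < complex.Im z -> derivable (f : C^o -> C^o) z 1.
Hypothesis fM : forall z : C, 0 <= complex.Im z -> normc (f z) <= M.
Hypothesis f_ge0 : forall z : C, 0 <= complex.Im z -> 0 <= complex.Im (f z).
Let phi (t : R) : R := complex.Im (f t%:C).

Lemma continuous_boundary_Im : continuous phi.
Proof.
move=> t; have ft : derivable (f : C^o -> C^o) t%:C 1 by apply: fdiff; rewrite /= oppr_lt0.
have [D /cdiff_closed_form/closed_form_continuous2[ct _]] := derivable_cdiff ft.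
apply/cvgrPdist_le => r /ct[d d0 hd].
near=> s; rewrite distrC; apply: (hd s 0); last by rewrite /= subrr normr0.
by rewrite distrC; near: s; apply: cvgr_dist_lt.
Unshelve. all: by end_near. Qed.

Lemma phi_ge0 t : 0 <= phi t. Proof. exact: f_ge0. Qed.

Lemma cvg_atan_itv (x y : R) : 0 < y ->
  atan ((n%:R - x) / y) - atan ((- n%:R - x) / y) @[n --> \oo] --> (pi : R).
Proof.
move=> y0.
have h (c : R) : (n%:R + c) / y @[n --> \oo] --> +oo.
  apply/cvgryPge => A; near=> n; rewrite ler_pdivlMr// -lerBlDr.
  by near: n; exact: nbhs_infty_ger.
have -> : (fun n : nat => atan ((n%:R - x) / y) - atan ((- n%:R - x) / y)) =
   (fun n : nat => atan ((n%:R + - x) / y) + atan ((n%:R + x) / y)).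
  apply/funext => n; rewrite (_ : (- n%:R - x) / y = - ((n%:R + x) / y)) ?atanN ?opprK//.
  by rewrite -mulNr opprD.
have -> : (pi : R) = pi / 2 + pi / 2 by rewrite -splitr.
apply: cvgD.
  by apply: (cvg_comp _ _ (h (- x))); exact: cvgy_atan.
by apply: (cvg_comp _ _ (h x)); exact: cvgy_atan.
Unshelve. all: by end_near. Qed.

(** Over [[-n, n]] the integral of [(phi - v)] against the kernel vanishes in the limit, while the
    kernel itself integrates to [pi]. Nonnegativity of [phi] lets the truncated integrals increase
    to the full one. *)
Lemma poisson_formula (x y : R) : 0 < y ->
  (\int[mu]_t (phi t * poisson x y t)%:E = (pi * complex.Im (f (x +i* y)))%:E)%E.
Proof.
move=> y0; set v := complex.Im _.
have fz : derivable (f : C^o -> C^o) (x +i* y) 1 by apply: fdiff => /=; have := e0; lra.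
have [D fD] := derivable_cdiff fz.
have cphi := continuous_boundary_Im.
have ck := continuous_poisson (x := x) y0.
have cpk : continuous (fun t => phi t * poisson x y t).
  by move=> t; apply: cvgM; [exact: cphi|exact: ck].
pose I n : set R := `[- n%:R, n%:R]%classic.
have segE n : (0 < n)%N -> seg (fun t => phi t * poisson x y t) (- n%:R) n%:R =
   seg (fun t => (phi t - v) * poisson x y t) (- n%:R) n%:R +
   v * (atan ((n%:R - x) / y) - atan ((- n%:R - x) / y)).
  move=> n0; have nn : - n%:R < n%:R :> R by rewrite gtrN// ltr0n.
  rewrite -seg_poisson// -[v * seg _ _ _]RintegralZl//; last first.
    by apply: continuous_seg_integrable; apply: continuous_subspaceT.
  rewrite -segD; last 2 first.
  - apply: continuous_subspaceT => t; apply: cvgM; last exact: ck.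
    by apply: cvgB; [exact: cphi|exact: cvg_cst].
  - by apply: continuous_subspaceT => t; apply: cvgM; [exact: cvg_cst|exact: ck].
  congr (seg _ _ _); apply/funext => t; rewrite -/(poisson x y t); ring.
have seg_cvg : seg (fun t => phi t * poisson x y t) (- n%:R) n%:R @[n --> \oo] --> pi * v.
  have h0 : seg (fun t => (phi t - v) * poisson x y t) (- n%:R) n%:R @[n --> \oo] --> (0:R).
    apply/cvgr0Pnorm_le => r r0.
    have M0 : 0 <= M by apply: le_trans (fM (z := x +i* y) (ltW y0)); exact: normc_ge0.
    near=> n.
    apply: le_trans (poisson_formula_trunc e0 fdiff fM y0 fD _) _.
      by near: n; exact: nbhs_infty_gtr.
    have n0 : 0 < n%:R :> R by near: n; exact: nbhs_infty_gtr.
    rewrite ler_pdivrMr// [leRHS]mulrC -ler_pdivrMr//.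
    by near: n; exact: nbhs_infty_ger.
  have h1 : v * (atan ((n%:R - x) / y) - atan ((- n%:R - x) / y)) @[n --> \oo] --> v * pi.
    by apply: cvgM; [exact: cvg_cst|exact: cvg_atan_itv].
  have hh := cvgD h0 h1; rewrite add0r [v * pi]mulrC in hh; apply: cvg_trans; last exact: hh.
  apply: near_eq_cvg; near=> n; rewrite /= segE//.
  by near: n; exists 1%N.
have bigI : \bigcup_n I n = setT.
  rewrite -subTset => t _; exists (Num.bound `|t|) => //.
  by rewrite /I /= in_itv/= -ler_norml ltW// archi_boundP.
have mpk : measurable_fun setT (EFin \o (fun t => phi t * poisson x y t)).
  by apply/measurable_EFinP; apply: continuous_measurable_fun.
have c1 : (\int[mu]_(t in I n) (phi t * poisson x y t)%:E @[n --> \oo] -->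
   \int[mu]_(t in \bigcup_n I n) (phi t * poisson x y t)%:E)%E.
  apply: ge0_nondecreasing_set_cvg_integral => //.
  - move=> n m nm; apply/subsetPset; apply: subset_itv; rewrite bnd_simp ?lerN2 ler_nat//.
  - by move=> n; exact: measurable_itv.
  - by move=> n; exact: measurable_funTS.
  - by move=> n t _; rewrite lee_fin mulr_ge0 ?phi_ge0// ltW// poisson_gt0.
rewrite bigI in c1; apply: (cvg_unique _ c1) => //.
have -> : (fun n => \int[mu]_(t in I n) (phi t * poisson x y t)%:E)%E =
   (fun n => (seg (fun t => phi t * poisson x y t) (- n%:R) n%:R)%:E).
  apply/funext => n; rewrite /seg /Rintegral fineK//; apply: integrable_fin_num => //.
  by apply: continuous_seg_integrable; apply: continuous_subspaceT.
exact/cvg_EFin/seg_cvg/nearW.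
Unshelve. all: by end_near. Qed.

(** The cut-off integral of [phi] at level [N] is [pi N Im (f (iN))], by the Poisson formula at
    [iN]. *)
Lemma boundary_mass (S : R) : (forall y, 0 < y -> y * complex.Im (f (0 +i* y)) <= S) ->
  (\int[mu]_t (phi t)%:E <= (pi * S)%:E)%E.
Proof.
move=> hS; have cphi := continuous_boundary_Im.
apply: (@integral_le_of_cutoff _ mu) => [|t|n]; [exact: continuous_measurable_fun|exact: phi_ge0|].
under eq_integral => t _.
  rewrite (_ : (_ * _)%:E = n.+1%:R%:E * (phi t * poisson 0 n.+1%:R t)%:E)%E; last first.
    by rewrite -EFinM /poisson subr0; congr EFin; rewrite expr2; ring.
  over.
rewrite /= ge0_integralZl_EFin//.
- by rewrite poisson_formula// -EFinM lee_fin mulrCA ler_wpM2l ?pi_ge0// hS.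
- by move=> t _; rewrite lee_fin mulr_ge0 ?phi_ge0// ltW// poisson_gt0.
- apply/measurable_EFinP; apply: continuous_measurable_fun => t.
  by apply: cvgM; [exact: cphi|exact: continuous_poisson].
Qed.

End PoissonFormulaLine.

(** * The Herglotz representation *)

Section Helly.
Context {R : realType}.

(** The values at the rationals are points of a compact product of segments and have a cluster point
    [p]. The limit [G x] is the infimum of [p] over the rationals strictly to the right of [x],
    which makes it right-continuous; at a continuity point nearby rationals on both sides squeeze
    [F (k N) x]. *)
Lemma helly (F : nat -> R -> R) (S : R) :
  (forall n, {homo F n : x y / x <= y}) -> (forall n x, 0 <= F n x <= S) ->
  exists (G : R -> R) (k : nat -> nat),
    [/\ {homo G : x y / x <= y}, right_continuous G,
        forall x, 0 <= G x <= S, forall N, (N <= k N)%N &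
        forall x, {for x, continuous G} -> F (k N) x @[N --> \oo] --> G x].
Proof.
move=> Fnd FS.
(* An enumeration of the rationals; numbers that code no rational are sent to 0, a harmless
   repetition. *)
pose q (j : nat) : R := ratr (odflt 0 (unpickle j)).
have qd x y : x < y -> exists j, x < q j < y.
  move=> /rat_in_itvoo[r]; rewrite in_itv/= => hr.
  by exists (pickle r); rewrite /q pickleK.
have cK := @tychonoff nat (fun=> R) (fun=> `[0, S]%classic) (fun=> @segment_compact _ 0 S).
pose u (N : nat) : prod_topology (fun _ : nat => R) := fun j => F N (q j).
have [p [pS pcl]] := cK (u @ \oo) _ (ltac:(by exists 0%N => // N _ j; rewrite /= in_itv/= FS)).
(* Arbitrarily late terms enter each neighbourhood of the cluster point; the neighbourhood used here
   constrains the coordinates [0, ..., N]. *)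
have approx (N : nat) : exists n, (N <= n)%N /\
    forall j, (j <= N)%N -> `|F n (q j) - p j| < N.+1%:R^-1.
  pose B : set (prod_topology (fun _ : nat => R)) :=
    [set g | forall j, (j < N.+1)%N -> `|g j - p j| < N.+1%:R^-1].
  have nB : nbhs p B.
    have : forall m, nbhs p [set g : prod_topology (fun _ : nat => R) |
        forall j, (j < m)%N -> `|g j - p j| < N.+1%:R^-1].
      elim=> [|m IH]; first by apply: filterS filterT => g _ j.
      have hm : nbhs p [set g : prod_topology (fun _ : nat => R) | `|g m - p m| < N.+1%:R^-1].
        have /= cp := @proj_continuous _ (fun _ : nat => R) m p.
        apply: (cp [set r : R | `|r - p m| < N.+1%:R^-1]).
        apply/nbhs_ballP; exists N.+1%:R^-1; first by rewrite /= invr_gt0.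
        by move=> r; rewrite -ball_normE /= distrC.
      apply: filterS2 hm IH => g h1 h2 j; rewrite ltnS leq_eqVlt => /predU1P[->//|].
      exact: h2.
    exact.
  have := pcl [set g | exists2 n, (N <= n)%N & g = u n] B.
  case=> //; first by exists N => // n Nn; exists n.
  by move=> _ [[n Nn ->] Bn]; exists n; split => // j jN; apply: Bn.
have [k kP] := choice approx.
have kN N : (N <= k N)%N by have [] := kP N.
have kcvg j : F (k N) (q j) @[N --> \oo] --> p j.
  apply/cvgrPdist_lt => r r0; near=> N; rewrite distrC.
  have jN : (j <= N)%N by near: N; exact: nbhs_infty_ge.
  have [_ /(_ j jN) /lt_trans] := kP N; apply.
  by near: N; exact: near_infty_natSinv_lt (PosNum r0).
have pnd i j : q i <= q j -> p i <= p j.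
  move=> ij; apply: (ler_cvg_to (kcvg i) (kcvg j)).
  by apply: nearW => N; exact: Fnd.
pose A x := [set p j | j in [set j | x < q j]].
pose G x := inf (A x).
have A0 x : A x !=set0.
  by have [j /andP[xj _]] := qd x (x + 1) (ltac:(lra)); exists (p j); exists j.
have pS' j : 0 <= p j <= S by have := pS j; rewrite /= in_itv.
have lbA x : has_lbound (A x) by exists 0 => _ [j _ <-]; have /andP[] := pS' j.
have Gle x j : x < q j -> G x <= p j by move=> xj; apply: ge_inf => //; exists j.
have Gge x j : q j <= x -> p j <= G x.
  move=> jx; apply: lb_le_inf => // _ [i /= xi <-]; apply: pnd.
  exact: (le_trans jx (ltW xi)).
have Gnd : {homo G : x y / x <= y}.
  move=> x y xy; apply: lb_le_inf => // _ [i /= yi <-]; apply: Gle.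
  exact: le_lt_trans yi.
exists G, k; split => //.
- move=> x; apply/cvgrPdist_le => r r0.
  have [_ [j /= xj <-] hj] : exists2 a, A x a & a < G x + r.
    by apply: inf_adherent => //; split.
  near=> y; have xy : x <= y by apply/ltW; near: y; exact: nbhs_right_gt.
  have yj : y < q j by near: y; exact: nbhs_right_lt.
  rewrite ler0_norm; last by rewrite subr_le0 Gnd.
  by have := Gle y j yj; lra.
- move=> x; apply/andP; split; first by apply: lb_le_inf => // _ [j _ <-]; have /andP[] := pS' j.
  by have [a [j xj aj]] := A0 x; apply: le_trans (Gle _ _ xj) _; have /andP[] := pS' j.
- move=> x /cvgrPdist_lt cG; apply/cvgrPdist_lt => r r0.
  have r20 : 0 < r / 2 by lra.
  have [d /= d0 hd] := cG _ r20.
  have [i /andP[i1 i2]] := qd (x - d) x (ltac:(lra)).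
  (* A second rational is called for because [Gle] asks for strict inequality: [p i] is bounded
     below by [G] at a point strictly left of [q i]. *)
  have [i' /andP[i1' i2']] := qd (x - d) (q i) i1.
  have [j /andP[j1 j2]] := qd x (x + d) (ltac:(lra)).
  have hi : G x - r / 2 < p i.
    have : `|G x - G (q i')| < r / 2.
      by apply: hd; rewrite /ball_ /= ltr_norml; lra.
    by rewrite ltr_norml; have := Gle _ _ i2'; lra.
  have hj : p j < G x + r / 2.
    have : `|G x - G (q j)| < r / 2.
      by apply: hd; rewrite /ball_ /= ltr_norml; lra.
    by rewrite ltr_norml; have := Gge _ _ (lexx (q j)); lra.
  have /cvgrPdist_lt/(_ _ r20) ci := kcvg i.
  have /cvgrPdist_lt/(_ _ r20) cj := kcvg j.
  near=> N; rewrite ltr_norml.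
  have hi' : `|p i - F (k N) (q i)| < r / 2.
    by near: N; exact: ci.
  have hj' : `|p j - F (k N) (q j)| < r / 2.
    by near: N; exact: cj.
  have f1 := Fnd (k N) _ _ (ltW i2); have f2 := Fnd (k N) _ _ (ltW j1).
  by move: hi' hj'; rewrite !ltr_norml; lra.
Unshelve. all: by end_near. Qed.

End Helly.

(** * The layer-cake formula for Poisson integrals *)

Section LayerCake.
Context {R : realType}.
Local Notation mu := (@lebesgue_measure R).
Variables (x y : R).
Hypothesis y0 : 0 < y.

(** The distance from [x] at which the kernel takes the value [s], for [0 < s <= 1 / y]. *)
Definition poisson_rad (s : R) : R := Num.sqrt (y / s - y ^+ 2).

(* The superlevel set of [poisson x y] at height [s], made half-open so that a
   right-continuous distribution function measures it. *)
Definition poisson_layer (s : R) : set R :=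
  `]x - poisson_rad s, x + poisson_rad s]%classic.

(** The second disjunct adds the right endpoint. Inequalities between functions of [(t, s)] make
    membership jointly measurable, as Tonelli's theorem requires. *)
Lemma poisson_layerE (t s : R) : 0 < s -> s < y^-1 ->
  (t \in poisson_layer s) = (s < poisson x y t) || ((x < t) && (s <= poisson x y t)).
Proof.
move=> s0 sy; rewrite /poisson_layer mem_setE in_itv/=.
have r0 : 0 < y / s - y ^+ 2.
  rewrite subr_gt0 ltr_pdivlMr// expr2 -mulrA gtr_pMr//.
  by rewrite -(ltr_pdivlMl _ _ y0) mulr1.
set r := poisson_rad s.
have rr0 : 0 < r by rewrite sqrtr_gt0.
have r2 : r ^+ 2 = y / s - y ^+ 2 by rewrite sqr_sqrtr// ltW.
have d0 := poisson_den_gt0 x t y0.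
have lt1 : (s < poisson x y t) = (`|t - x| < r).
  rewrite /poisson ltr_pdivlMr// mulrC -ltr_pdivlMr// -ltrBrDr -r2.
  by rewrite -real_normK ?num_real// ltr_sqr ?nnegrE// ltW.
have le1 : (s <= poisson x y t) = (`|t - x| <= r).
  rewrite /poisson ler_pdivlMr// mulrC -ler_pdivlMr// -lerBrDr -r2.
  by rewrite -real_normK ?num_real// ler_sqr ?nnegrE// ltW.
rewrite lt1 le1; apply/idP/idP.
  move=> /andP[t1 t2]; have [xt|tx] := ltP x t.
    by rewrite /= ger0_norm; [rewrite lerBlDl t2 orbT|lra].
  by rewrite orbF ler0_norm; lra.
move=> /orP[|/andP[xt]]; first by rewrite ltr_norml; lra.
by rewrite ler_norml; lra.
Qed.

Let b (p : measurableTypeR R * measurableTypeR R) : bool := [&& 0 < p.2, p.2 < y^-1 &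
  (p.2 < poisson x y p.1) || ((x < p.1) && (p.2 <= poisson x y p.1))].

Let measurable_b : measurable_fun [set: measurableTypeR R * measurableTypeR R] b.
Proof.
have mk : measurable_fun [set: measurableTypeR R * measurableTypeR R]
    (fun p => poisson x y p.1).
  by apply: measurableT_comp => //; apply: continuous_measurable_fun; exact: continuous_poisson.
apply: measurable_and; first exact: measurable_fun_ltr.
apply: measurable_and; first exact: measurable_fun_ltr.
apply: measurable_or; first exact: measurable_fun_ltr.
by apply: measurable_and; [exact: measurable_fun_ltr|exact: measurable_fun_ler].
Qed.

(** Tonelli's theorem for [phi t] times the indicator of the layers: for fixed [t] the admissible
    heights form an interval from 0 to [poisson x y t]. The measurability in [s] is a by-product,
    needed later for dominated convergence. *)
Lemma layer_cake (m : {sigma_finite_measure set (measurableTypeR R) -> \bar R})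
    (phi : R -> R) : measurable_fun setT phi -> (forall t, 0 <= phi t) ->
  measurable_fun `]0, y^-1[ (fun s => (\int[m]_(t in poisson_layer s) (phi t)%:E)%E) /\
  (\int[m]_t (phi t * poisson x y t)%:E =
   \int[mu]_(s in `]0%R, (y^-1)%R[) \int[m]_(t in poisson_layer s) (phi t)%:E)%E.
Proof.
move=> mphi phi0.
pose g (p : measurableTypeR R * measurableTypeR R) : \bar R := (phi p.1 * (b p)%:R)%:E.
have g0 p : (0 <= g p)%E by rewrite lee_fin mulr_ge0.
have mg : measurable_fun setT g.
  apply/measurable_EFinP; apply: measurable_funM.
    exact: (measurableT_comp mphi).
  rewrite (_ : (fun _ => _) = \1_[set p | b p]).
    have -> : [set p | b p] = b @^-1` [set true] by apply/seteqP; split.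
    by apply: measurable_indic; rewrite -[X in measurable X]setTI; apply: measurable_b.
  by apply/funext => p; rewrite indicE; congr ((nat_of_bool _)%:R); apply/idP/idP; rewrite inE.
have inner_s s : (\int[m]_t g (t, s) = ((fun s => \int[m]_(t in poisson_layer s) (phi t)%:E) \_ `]0%R, (y^-1)%R[) s)%E.
  rewrite patchE; case: ifPn => [|sI].
    rewrite inE/= in_itv/= => /andP[s0 sy].
    rewrite [RHS]integral_mkcond; apply: eq_integral => t _.
    rewrite patchE poisson_layerE// /g /b /= s0 sy /=.
    by case: ifP; rewrite ?mulr1 ?mulr0.
  apply: integral0_eq => t _; rewrite /g /b /=.
  move: sI; rewrite notin_setE /= in_itv/= => /negP.
  by case: (0 < s) => //=; [case: (s < y^-1)|] => //=; rewrite mulr0.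
have inner_t t : (\int[mu]_s g (t, s) = (phi t * poisson x y t)%:E)%E.
  have kt0 := poisson_gt0 x t y0.
  have -> : (fun s => g (t, s)) = (fun s => ((phi t)%:E * (\1_[set s | b (t, s)] s)%:E)%E).
    by apply/funext => s; rewrite -EFinM indicE /g; congr ((_ * (nat_of_bool _)%:R)%:E); apply/idP/idP; rewrite inE.
  have mS : measurable [set s | b (t, s)].
    have mp : measurable_fun setT (fun s : measurableTypeR R => b (t, s)).
      exact: (measurableT_comp measurable_b).
    have -> : [set s | b (t, s)] = (fun s => b (t, s)) @^-1` [set true] by apply/seteqP; split.
    by rewrite -[X in measurable X]setTI; apply: mp.
  rewrite ge0_integralZl_EFin//; last exact/measurable_EFinP/measurable_indic.
  rewrite integral_indic// setIT EFinM; congr (_ * _)%E.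
  have [xt|tx] := ltP x t.
    have -> : [set s | b (t, s)] = `]0%R, poisson x y t]%classic.
      apply/seteqP; split => s /=; rewrite /b /= xt in_itv/=.
        by move=> /and3P[-> _ /orP[/ltW//|]].
      move=> /andP[-> sk]; rewrite sk orbT andbT.
      apply: le_lt_trans sk _.
      rewrite /poisson ltr_pdivrMr ?poisson_den_gt0// mulrDr [y^-1 * y ^+ 2]mulrC expr2 mulfK ?gt_eqF//.
      by rewrite ltrDr mulr_gt0 ?invr_gt0// -expr2 exprn_gt0 ?subr_gt0.
    by have := lebesgue_measure_itv `]0, poisson x y t]; rewrite /= lte_fin kt0 sube0.
  have -> : [set s | b (t, s)] = `]0%R, poisson x y t[%classic.
    have xt : (x < t) = false by apply/negbTE; rewrite -leNgt.
    apply/seteqP; split => s /=; rewrite /b /= xt /= orbF in_itv/=.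
      by move=> /and3P[-> _ ->].
    by move=> /andP[-> sk]; rewrite sk (lt_le_trans sk)//= poisson_le.
  by have := lebesgue_measure_itv `]0, poisson x y t[; rewrite /= lte_fin kt0 sube0.
split.
  have := measurable_fun_fubini_tonelli_G (m1 := m) g mg g0.
  rewrite /fubini_G; under eq_fun do rewrite inner_s.
  by move=> h; apply/(measurable_restrictT _ (measurable_itv _)).
have := fubini_tonelli (m1 := m) (m2 := mu) g mg g0.
under eq_integral do rewrite inner_t.
by under [in RHS]eq_integral do rewrite inner_s; rewrite -integral_mkcond.
Qed.

End LayerCake.

(** * Distribution functions and their measures *)

Section DistributionFunctions.
Context {R : realType}.
Local Notation C := (R[i]).
Local Notation normc := Normc.normc.
Local Notation mu := (@lebesgue_measure R).

Lemma countable_discontinuity (G : R -> R) : {homo G : x y / x <= y} ->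
  right_continuous G -> countable [set u | ~ {for u, continuous G}].
Proof.
move=> Gnd Grc.
have sub : [set u | ~ {for u, continuous G}] `<=`
    \bigcup_n [set u | (u \in `](- n%:R), n%:R[) /\ discontinuity G u].
  move=> u /= nc; exists (Num.bound `|u|) => //=; split.
    by rewrite in_itv/= -ltr_norml archi_boundP.
  have cl : cvg (G x @[x --> u^'-]).
    apply: nondecreasing_at_left_is_cvgr.
      by apply: nearW => a b c _ _; exact: Gnd.
    by apply: nearW => a; exists (G u) => _ /= [b + <-]; rewrite in_itv/= => /andP[_ bu]; exact/Gnd/ltW.
  split => //; first by apply: (cvgP (G u)); exact: Grc.
  have -> : lim (G x @[x --> u^'+]) = G u by apply/cvg_lim => //; exact: Grc.
  apply/eqP => lG; apply: nc.
  rewrite lG in cl.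
  by apply/left_right_continuousP; split => //; exact: Grc.
apply: (sub_countable (subset_card_le sub)).
apply: bigcup_countable => // n _; apply: discontinuity_countable.
by move=> x y _ _; exact: Gnd.
Qed.

Lemma lebesgue_stieltjes_measure_oc (G : cumulative R R) (a b : R) : a <= b ->
  lebesgue_stieltjes_measure G `]a, b]%classic = (G b - G a)%:E.
Proof.
move=> ab; rewrite /lebesgue_stieltjes_measure /measure_extension.
by rewrite measurable_mu_extE/=; [rewrite wlength_itv_bnd|exact: is_ocitv].
Qed.

(** The Lebesgue-Stieltjes measure of [G]; it is finite because the intervals []-n, n]] increase to
    the line and each has mass at most [S]. *)
Lemma finite_measure_of_cdf (G : R -> R) (S : R) : {homo G : x y / x <= y} ->
  right_continuous G -> (forall x, 0 <= G x <= S) ->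
  exists sigma : {finite_measure set (measurableTypeR R) -> \bar R},
    forall a b, a <= b -> sigma `]a, b]%classic = (G b - G a)%:E.
Proof.
move=> Gnd Grc GS.
pose cG : cumulative R R := HB.pack G (isCumulative.Build R _ R G Gnd Grc).
pose m := lebesgue_stieltjes_measure cG.
have mE a b : a <= b -> m `]a, b]%classic = (G b - G a)%:E.
  by move=> ab; rewrite /m lebesgue_stieltjes_measure_oc.
have fin : fin_num_fun (m : set (measurableTypeR R) -> \bar R).
  apply: lty_fin_num_fun.
  pose I (n : nat) : set (measurableTypeR R) := `]- n%:R, n%:R]%classic.
  have cI : m (I n) @[n --> \oo] --> m (\bigcup_n I n).
    apply: nondecreasing_cvg_mu => //.
    - by move=> n; exact: measurable_itv.
    - by apply: bigcup_measurable => n _; exact: measurable_itv.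
    - by move=> i j ij; apply/subsetPset; apply: subset_itv; rewrite bnd_simp ?lerN2 ler_nat.
  rewrite (bigcup_itvT false false) in cI.
  apply: (@le_lt_trans _ _ S%:E); last by rewrite ltry.
  apply: (cvge_le _ cI) => //; apply: nearW => n.
  rewrite mE; last by rewrite (@le_trans _ _ 0)// oppr_le0.
  have := GS n%:R; have := GS (- n%:R); rewrite lee_fin; lra.
pose sigma : {finite_measure set (measurableTypeR R) -> \bar R} :=
  HB.pack (lebesgue_stieltjes_measure cG) (Measure_isFinite.Build _ _ _ m fin).
by exists sigma => a b ab; exact: mE.
Qed.

End DistributionFunctions.

(** * Representation of the imaginary part *)

Section HerglotzRepresentation.
Context {R : realType}.
Local Notation C := (R[i]).
Local Notation normc := Normc.normc.
Local Notation mu := (@lebesgue_measure R).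

Lemma derivable_shift (w : C -> C) (c z : C) :
  derivable (w : C^o -> C^o) (z + c) 1 -> derivable ((fun t => w (t + c)) : C^o -> C^o) z 1.
Proof.
rewrite /derivable /shift /=.
rewrite (_ : (fun h => _) = (fun h : C => h^-1 *: (w (h *: 1 + z + c) - w (z + c)))) //.
by apply/funext => h; rewrite addrA.
Qed.

Lemma density_cdf (phi : R -> R) (S : R) : measurable_fun setT phi ->
  (forall t, 0 <= phi t) -> (\int[mu]_t (phi t)%:E <= S%:E)%E ->
  exists F : R -> R, [/\ {homo F : x y / x <= y}, forall x, 0 <= F x <= S &
    forall a b, a <= b -> (\int[mu]_(t in `]a, b]) (phi t)%:E = (F b - F a)%:E)%E].
Proof.
move=> mphi phi0 intS.
pose I (A : set R) := (\int[mu]_(t in A) (phi t)%:E)%E.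
have I0 A : (0 <= I A)%E by apply: integral_ge0 => t _; rewrite lee_fin.
have mE A : measurable_fun A (EFin \o phi) by apply/measurable_EFinP; exact: measurable_funTS.
have IS (A B : set (measurableTypeR R)) : measurable A -> measurable B -> A `<=` B -> (I A <= I B)%E.
  move=> mA mB AB; apply: ge0_subset_integral => //; first exact: mE.
  by move=> t _; rewrite lee_fin.
have IT A : measurable A -> (I A <= S%:E)%E.
  by move=> mA; apply: le_trans intS; exact: IS.
have Ifin A : measurable A -> I A \is a fin_num.
  by move=> mA; rewrite ge0_fin_numE// (le_lt_trans (IT _ mA))// ltry.
exists (fun x => fine (I `]-oo, x]%classic)); split.
- move=> x y xy; rewrite fine_le// ?Ifin//; try exact: measurable_itv.
  by apply: IS; [exact: measurable_itv|exact: measurable_itv|apply: subset_itvl; rewrite bnd_simp].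
- move=> x; rewrite fine_ge0//= -lee_fin fineK ?Ifin//; first exact: IT.
- move=> a b ab; rewrite EFinB !fineK ?Ifin//.
  have -> : `]-oo, b]%classic = `]-oo, a]%classic `|` `]a, b]%classic :> set R.
    by rewrite -itv_bndbnd_setU// bnd_simp.
  rewrite /I integral_setU//=.
  + by rewrite addeAC subee ?add0e//; exact: (Ifin `]-oo, a]%classic).
  + exact: mE.
  + by apply/disj_setPS => t [/=]; rewrite !in_itv/= => ta /andP[/lt_le_trans/(_ ta)]; rewrite ltxx.
Qed.

(* The layer-cake formula turns Poisson integrals into Lebesgue integrals of
   increments of distribution functions, and all but countably many superlevel
   intervals end at continuity points of the Helly limit [G]; so convergence of
   distribution functions suffices, without weak convergence of measures. *)
Lemma herglotz_Im (w : C -> C) (S : R) :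
  (forall z : C, 0 < complex.Im z -> derivable (w : C^o -> C^o) z 1) ->
  (forall z : C, 0 < complex.Im z -> 0 <= complex.Im (w z)) ->
  (forall z : C, 0 < complex.Im z -> normc (w z) <= S / complex.Im z) ->
  exists sigma : {finite_measure set (measurableTypeR R) -> \bar R},
    forall x y, 0 < y ->
      (\int[sigma]_t (poisson x y t)%:E = (complex.Im (w (x +i* y)))%:E)%E.
Proof.
move=> wd wi wS.
pose e (n : nat) : R := n.+1%:R^-1.
have e0 n : 0 < e n by rewrite invr_gt0.
pose f n (z : C) := w (z + 0 +i* e n).
have fd n (z : C) : - e n < complex.Im z -> derivable (f n : C^o -> C^o) z 1.
  move=> hz; apply: (@derivable_shift w (0 +i* e n)); apply: wd.
  by rewrite raddfD/=; lra.
have fM n (z : C) : 0 <= complex.Im z -> normc (f n z) <= S / e n.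
  move=> hz; have h : 0 < complex.Im (z + 0 +i* e n) by rewrite raddfD/= ltr_wpDl.
  have S0 : 0 <= S.
    have := le_trans (normc_ge0 _) (wS _ h).
    by rewrite pmulr_lge0// invr_gt0.
  apply: le_trans (wS _ h) _; rewrite ler_wpM2l// lef_pV2 ?posrE//.
  by rewrite raddfD/= lerDr.
have fi n (z : C) : 0 <= complex.Im z -> 0 <= complex.Im (f n z).
  by move=> hz; apply: wi; rewrite raddfD/= ltr_wpDl.
pose phi n (t : R) := complex.Im (f n t%:C).
have mphi n : measurable_fun setT (phi n).
  by apply: continuous_measurable_fun; exact: (continuous_boundary_Im (e0 n) (fd n)).
have phi0 n t : 0 <= phi n t by exact: fi.
have mass n : (\int[mu]_t (phi n t)%:E <= (pi * S)%:E)%E.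
  apply: (boundary_mass (e0 n) (fd n) (fM n) (fi n)) => y y0.
  have h : 0 < complex.Im (0 +i* y + 0 +i* e n : C) by rewrite /= addr_gt0.
  have := le_trans (normc_Im _) (wS _ h) => /(le_trans (ler_norm _)).
  have S0 : 0 <= S.
    by have := le_trans (normc_ge0 _) (wS _ h); rewrite pmulr_lge0// invr_gt0.
  move=> /= h1; rewrite -ler_pdivlMl// mulrC; apply: le_trans h1 _.
  by rewrite ler_wpM2l// lef_pV2 ?posrE//= ?addr_gt0// lerDl ltW.
have [F FP] := choice (fun n => density_cdf (mphi n) (phi0 n) (mass n)).
have Fnd n : {homo F n : x y / x <= y} by have [] := FP n.
have FS n x : 0 <= F n x <= pi * S by have [_ + _] := FP n; apply.
have FE n a b : a <= b -> (\int[mu]_(t in `]a, b]) (phi n t)%:E = (F n b - F n a)%:E)%E.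
  by have [_ _] := FP n; apply.
have [G [k [Gnd Grc GS kN Gcvg]]] := helly Fnd FS.
have [sigma sigmaE] := finite_measure_of_cdf Gnd Grc GS.
have key x y : 0 < y -> (\int[sigma]_t (poisson x y t)%:E = (pi * complex.Im (w (x +i* y)))%:E)%E.
  move=> y0.
  pose D : set (measurableTypeR R) := `]0, y^-1[%classic.
  pose a s := x - poisson_rad y s; pose b s := x + poisson_rad y s.
  have ab s : a s <= b s by rewrite /a /b lerD2l ge0_cp// sqrtr_ge0.
  have LN n : measurable_fun D (fun s => (F n (b s) - F n (a s))%:E) /\
    (\int[mu]_(s in D) (F n (b s) - F n (a s))%:E = (pi * complex.Im (f n (x +i* y)))%:E)%E.
    have [m1 m2] := layer_cake x y0 mu (mphi n) (phi0 n).
    have E s : (\int[mu]_(t in poisson_layer x y s) (phi n t)%:E = (F n (b s) - F n (a s))%:E)%E.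
      exact: (FE n (a s) (b s) (ab s)).
    split.
      rewrite (_ : (fun s => _) = (fun s => (\int[mu]_(t in poisson_layer x y s) (phi n t)%:E)%E))//.
      by apply/funext => s; rewrite E.
    rewrite -(poisson_formula (e0 n) (fd n) (fM n) (fi n) x y0) m2.
    by apply: eq_integral => s _; rewrite E.
  have [m1 m2] := layer_cake x y0 sigma (phi := cst 1) (measurable_cst _) (fun=> ler01).
  have E s : (\int[sigma]_(t in poisson_layer x y s) (cst 1%R t)%:E = (G (b s) - G (a s))%:E)%E.
    transitivity (\int[sigma]_(t in poisson_layer x y s) (cst 1%E t))%E; first by [].
    rewrite integral_cst; last exact: measurable_itv.
    by rewrite mul1e; exact: (sigmaE (a s) (b s) (ab s)).
  have mG : measurable_fun D (fun s => (G (b s) - G (a s))%:E).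
    rewrite (_ : (fun s => _) = (fun s => (\int[sigma]_(t in poisson_layer x y s) (cst 1%R t)%:E)%E))//.
    by apply/funext => s; rewrite E.
  have -> : (\int[sigma]_t (poisson x y t)%:E = \int[mu]_(s in D) (G (b s) - G (a s))%:E)%E.
    transitivity (\int[sigma]_t (cst 1%R t * poisson x y t)%:E)%E.
      by apply: eq_integral => t _; rewrite mul1r.
    by rewrite m2; apply: eq_integral => s _; rewrite E.
  (* The exceptional heights: the kernel takes the value [s] at both ends [a s] and [b s], so if one
     of them is a discontinuity of [G], then [s] lies in this countable image. *)
  pose Nx := poisson x y @` [set u | ~ {for u, continuous G}].
  have Nx_count : countable Nx.
    by apply: (sub_countable (card_image_le _ _)); exact: countable_discontinuity.
  have Nx0 : mu.-negligible Nx.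
    apply/negligibleP; first exact: countable_measurable.
    exact: countable_lebesgue_measure0.
  have rad2 s : 0 < s -> s < y^-1 -> poisson_rad y s ^+ 2 = y / s - y ^+ 2.
    move=> s0 sy; rewrite sqr_sqrtr// subr_ge0 ler_pdivlMr// expr2 -mulrA ger_pMr//.
    by rewrite -(ler_pdivlMl _ _ y0) mulr1 ltW.
  have pa s : 0 < s -> s < y^-1 -> poisson x y (a s) = s /\ poisson x y (b s) = s.
    move=> s0 sy; rewrite /poisson /a /b.
    have -> : x - poisson_rad y s - x = - poisson_rad y s by ring.
    have -> : x + poisson_rad y s - x = poisson_rad y s by ring.
    rewrite sqrrN rad2// subrK; split; field; rewrite !gt_eqF//.
  have cv : (\int[mu]_(s in D) (F (k n) (b s) - F (k n) (a s))%:E @[n --> \oo] -->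
     \int[mu]_(s in D) (G (b s) - G (a s))%:E)%E.
    have h1 n : measurable_fun D (fun s => (F (k n) (b s) - F (k n) (a s))%:E).
      by have [] := LN (k n).
    have h2 : {ae mu, forall s, D s ->
        (F (k n) (b s) - F (k n) (a s))%:E @[n --> \oo] --> (G (b s) - G (a s))%:E}.
      apply: negligibleS Nx0 => s /= /not_implyP[Ds ncv].
      apply: contrapT => nNx; apply: ncv.
      move: Ds; rewrite /D /= in_itv/= => /andP[s0 sy].
      have [pas pbs] := pa s s0 sy.
      have ca : {for a s, continuous G}.
        by apply: contrapT => nc; apply: nNx; exists (a s).
      have cb : {for b s, continuous G}.
        by apply: contrapT => nc; apply: nNx; exists (b s).
      apply/cvg_EFin; first exact: nearW.
      by apply: cvgB; exact: Gcvg.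
    have h3 : mu.-integrable D (cst (pi * S)%:E).
      apply/integrableP; split; first exact: measurable_cst.
      rewrite (_ : (fun s => _) = cst `|(pi * S)%:E|%E)// integral_cst; last exact: measurable_itv.
      have := lebesgue_measure_itv `]0, y^-1[ => /= ->.
      by rewrite lte_fin invr_gt0 y0 sube0 -EFinM ltry.
    have h4 : {ae mu, forall s n, D s ->
        (`|(F (k n) (b s) - F (k n) (a s))%:E| <= cst (pi * S)%:E s)%E}.
      apply: aeW => s n _ /=; rewrite lee_fin ger0_norm; last by rewrite subr_ge0 Fnd.
      by have /andP[_ b1] := FS (k n) (b s); have /andP[b2 _] := FS (k n) (a s); lra.
    by have [] := @dominated_convergence _ (measurableTypeR R) R mu D (measurable_itv _) _ _ _ h1 mG h2 h3 h4.
  apply: (cvg_unique _ cv) => //.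
  have -> : (fun n => \int[mu]_(s in D) (F (k n) (b s) - F (k n) (a s))%:E)%E =
    (fun n => (pi * complex.Im (f (k n) (x +i* y)))%:E).
    by apply/funext => n; have [] := LN (k n).
  apply/cvg_EFin; first exact: nearW.
  apply: cvgM; first exact: cvg_cst.
  have [E0 hE0] := derivable_cdiff (wd (x +i* y) y0).
  have [cw _] := closed_form_continuous2 (cdiff_closed_form hE0).
  apply/cvgrPdist_le => r r0; have [d d0 hd] := cw r r0.
  near=> n; rewrite distrC /f.
  have -> : x +i* y + 0 +i* e (k n) = x +i* (y + e (k n)) by congr (_ +i* _); rewrite /= addr0.
  apply: hd; first by rewrite subrr normr0.
  rewrite /= addrC addKr ger0_norm ?ltW//.
  apply: le_lt_trans (_ : n.+1%:R^-1 < d).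
    by rewrite /e lef_pV2 ?posrE// ler_nat ltnS.
  by near: n; exact: near_infty_natSinv_lt (PosNum d0).
(* The normalization missing from the kernel is put into the measure. *)
have ip0 : 0 <= (pi : R)^-1 by rewrite invr_ge0 pi_ge0.
exists (mscale (NngNum ip0) sigma) => x y y0.
rewrite ge0_integral_mscale//.
- by rewrite key// -EFinM mulrA mulVf ?mul1r// gt_eqF// pi_gt0.
- by apply/measurable_EFinP; apply: continuous_measurable_fun; exact: continuous_poisson.
- by move=> t _; rewrite lee_fin ltW// poisson_gt0.
Unshelve. all: by end_near. Qed.

End HerglotzRepresentation.

(** * Complex-valued integrals and the Stieltjes transform *)

Section ComplexIntegral.
Context {R : realType}.
Local Notation C := (R[i]).
Local Notation normc := Normc.normc.
Variable sigma : {finite_measure set (measurableTypeR R) -> \bar R}.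
Implicit Types (f g : R -> C) (h : R -> R) (z : C).

Definition cmeasurable f := measurable_fun [set: measurableTypeR R] (fun t => complex.Re (f t)) /\
  measurable_fun [set: measurableTypeR R] (fun t => complex.Im (f t)).

Definition cintegrable f := sigma.-integrable setT (EFin \o (fun t => complex.Re (f t))) /\
  sigma.-integrable setT (EFin \o (fun t => complex.Im (f t))).

Lemma cmeasurableM f g : cmeasurable f -> cmeasurable g -> cmeasurable (fun t => f t * g t).
Proof.
move=> [f1 f2] [g1 g2]; split.
  rewrite (_ : (fun t => _) = (fun t => complex.Re (f t) * complex.Re (g t) - complex.Im (f t) * complex.Im (g t))).
    by apply: measurable_funB; apply: measurable_funM.
  by apply/funext => t; rewrite ReM.
rewrite (_ : (fun t => _) = (fun t => complex.Re (f t) * complex.Im (g t) + complex.Im (f t) * complex.Re (g t))).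
  by apply: measurable_funD; apply: measurable_funM.
by apply/funext => t; rewrite ImM.
Qed.

Lemma cmeasurable_real h : measurable_fun setT h -> cmeasurable (fun t => (h t)%:C).
Proof. by move=> mh; split => //; exact: measurable_cst. Qed.

Lemma cauchy_kernelE z t : (t%:C - z)^-1 =
  ((t - complex.Re z) / ((t - complex.Re z) ^+ 2 + complex.Im z ^+ 2))
  +i* (complex.Im z / ((t - complex.Re z) ^+ 2 + complex.Im z ^+ 2)).
Proof. by case: z => x y; congr (_ +i* _); rewrite /= sub0r sqrrN ?mulNr ?opprK. Qed.

Lemma cauchy_den_gt0 z t : complex.Im z != 0 ->
  0 < (t - complex.Re z) ^+ 2 + complex.Im z ^+ 2.
Proof. by move=> y0; rewrite ltr_wpDl ?sqr_ge0// exprn_even_gt0. Qed.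

Lemma continuous_cauchy_den z : complex.Im z != 0 ->
  continuous (fun t : R => ((t - complex.Re z) ^+ 2 + complex.Im z ^+ 2)^-1).
Proof.
move=> y0 t; apply: cvgV; first by rewrite gt_eqF ?cauchy_den_gt0.
apply: cvgD; last exact: cvg_cst.
by apply: cvgM; apply: cvgB; [exact: cvg_id|exact: cvg_cst|exact: cvg_id|exact: cvg_cst].
Qed.

Lemma cmeasurable_cauchy z : complex.Im z != 0 -> cmeasurable (fun t => (t%:C - z)^-1).
Proof.
move=> y0; split; under eq_fun do rewrite cauchy_kernelE /=.
  apply: continuous_measurable_fun => t; apply: cvgM; last exact: continuous_cauchy_den.
  by apply: cvgB; [exact: cvg_id|exact: cvg_cst].
apply: continuous_measurable_fun => t; apply: cvgM; last exact: continuous_cauchy_den.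
exact: cvg_cst.
Qed.

Lemma normc_cauchy z t : complex.Im z != 0 -> normc (t%:C - z)^-1 <= `|complex.Im z|^-1.
Proof.
move=> y0; rewrite Normc.normcV lef_pV2 ?posrE ?normr_gt0//.
  by apply: le_trans (normc_Im _); rewrite ImB/= sub0r normrN.
rewrite normc_gt0 subr_eq0; apply/eqP => tz; move: y0; rewrite -tz /=.
by rewrite eqxx.
Qed.

Lemma cintegrable_dom f h : cmeasurable f -> sigma.-integrable setT (EFin \o h) ->
  (forall t, normc (f t) <= h t) -> cintegrable f.
Proof.
move=> [m1 m2] ih fh; split.
  apply: (le_integrable _ _ _ ih) => //; first exact/measurable_EFinP.
  move=> t _ /=; rewrite lee_fin; apply: le_trans (normc_Re _) _.
  by apply: le_trans (fh t) (ler_norm _).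
apply: (le_integrable _ _ _ ih) => //; first exact/measurable_EFinP.
move=> t _ /=; rewrite lee_fin; apply: le_trans (normc_Im _) _.
by apply: le_trans (fh t) (ler_norm _).
Qed.

Lemma integrable_cst_finite (r : R) : sigma.-integrable setT (EFin \o (fun=> r)).
Proof. exact: finite_measure_integrable_cst. Qed.

Lemma cintegrable_bounded f (M : R) : cmeasurable f -> (forall t, normc (f t) <= M) -> cintegrable f.
Proof. by move=> mf fM; apply: (cintegrable_dom mf (integrable_cst_finite M)). Qed.

Lemma cintegrableD f g : cintegrable f -> cintegrable g -> cintegrable (fun t => f t + g t).
Proof.
move=> [f1 f2] [g1 g2]; split.
  rewrite (_ : _ \o _ = (fun t => (complex.Re (f t))%:E + (complex.Re (g t))%:E)%E); first exact: integrableD.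
  by apply/funext => t /=; rewrite raddfD.
rewrite (_ : _ \o _ = (fun t => (complex.Im (f t))%:E + (complex.Im (g t))%:E)%E); first exact: integrableD.
by apply/funext => t /=; rewrite raddfD.
Qed.

Lemma cintegrableZ z f : cintegrable f -> cintegrable (fun t => z * f t).
Proof.
move=> [f1 f2]; split.
  rewrite (_ : _ \o _ = (fun t => (complex.Re z)%:E * (complex.Re (f t))%:E - (complex.Im z)%:E * (complex.Im (f t))%:E)%E).
    by apply: integrableB => //; apply: integrableZl.
  by apply/funext => t /=; rewrite ReM EFinB !EFinM.
rewrite (_ : _ \o _ = (fun t => (complex.Re z)%:E * (complex.Im (f t))%:E + (complex.Im z)%:E * (complex.Re (f t))%:E)%E).
  by apply: integrableD => //; apply: integrableZl.
by apply/funext => t /=; rewrite ImM EFinD !EFinM.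
Qed.

Lemma cintegralD f g : cintegrable f -> cintegrable g ->
  cintegral sigma (fun t => f t + g t) = cintegral sigma f + cintegral sigma g.
Proof.
move=> [f1 f2] [g1 g2]; rewrite /cintegral; congr (_ +i* _) => /=.
  rewrite -RintegralD//; apply: eq_Rintegral => t _; exact: raddfD.
rewrite -RintegralD//; apply: eq_Rintegral => t _; exact: raddfD.
Qed.

Lemma cintegralZ z f : cintegrable f ->
  cintegral sigma (fun t => z * f t) = z * cintegral sigma f.
Proof.
move=> [f1 f2]; rewrite /cintegral; case: z => a b.
have i1 (r : R) : sigma.-integrable setT (EFin \o (fun t => r * complex.Re (f t))).
  by rewrite (_ : _ \o _ = (fun t => r%:E * (complex.Re (f t))%:E)%E)//; apply: integrableZl.
have i2 (r : R) : sigma.-integrable setT (EFin \o (fun t => r * complex.Im (f t))).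
  by rewrite (_ : _ \o _ = (fun t => r%:E * (complex.Im (f t))%:E)%E)//; apply: integrableZl.
congr (_ +i* _) => /=.
  rewrite -!RintegralZl// -RintegralB//; apply: eq_Rintegral => t _; by rewrite ReM.
rewrite -!RintegralZl// -RintegralD//; apply: eq_Rintegral => t _; by rewrite ImM addrC.
Qed.

Lemma cintegral_real h : cintegral sigma (fun t => (h t)%:C) = (Rintegral sigma setT h)%:C.
Proof.
rewrite /cintegral /=; congr (_ +i* _); rewrite /Rintegral (_ : (fun t => _) = cst 0%E)//.
by rewrite integral0.
Qed.

(** Multiplication by a unimodular constant [c] turns the integral into its modulus, which is then
    the integral of the real part of [c * f]. *)
Lemma normc_cintegral f h : cintegrable f -> sigma.-integrable setT (EFin \o h) ->
  (forall t, normc (f t) <= h t) -> normc (cintegral sigma f) <= Rintegral sigma setT h.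
Proof.
move=> fi hi fh; set I := cintegral sigma f.
have [I0|I0] := eqVneq (normc I) 0.
  rewrite I0; apply: Rintegral_ge0 => t _; apply: le_trans (fh t); exact: normc_ge0.
have nI0 : 0 < normc I by rewrite lt_neqAle eq_sym I0 normc_ge0.
pose c : C := I^* / (normc I)%:C.
have nc : normc c = 1.
  rewrite /c Normc.normcM Normc.normcV normc_real ger0_norm ?normc_ge0//.
  have -> : normc I^* = normc I by case: (I) => a b /=; rewrite sqrrN.
  by rewrite divff.
have cI : c * I = (normc I)%:C.
  have h0 : (normc I)%:C != 0 :> C by apply/eqP => -[/eqP]; apply/negP.
  apply: (mulIf h0); rewrite /c mulrAC divfK//.
  rewrite -(rmorphM (real_complex R)) -expr2 normc_sqr; case: (I) => a b /=.
  by apply/eqP; rewrite eq_complex /=; apply/andP; split; apply/eqP; ring.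
have := cintegralZ c fi; rewrite -/I cI => cE.
have -> : normc I = complex.Re (cintegral sigma (fun t => c * f t)) by rewrite cE.
rewrite /cintegral /=; apply: le_Rintegral => //.
  by have [] := cintegrableZ c fi.
move=> t _; apply: le_trans (ler_norm _) _; apply: le_trans (normc_Re _) _.
by rewrite Normc.normcM nc mul1r.
Qed.

Lemma cintegrable_cauchy z : complex.Im z != 0 -> cintegrable (fun t => (t%:C - z)^-1).
Proof.
move=> y0; apply: (@cintegrable_bounded _ `|complex.Im z|^-1); first exact: cmeasurable_cauchy.
by move=> t; exact: normc_cauchy.
Qed.

Lemma poisson_stieltjes (x y : R) :
  0 < y -> (\int[sigma]_t (poisson x y t)%:E = (complex.Im (stieltjes sigma (x +i* y)))%:E)%E.
Proof.
move=> y0; have yn0 : complex.Im (x +i* y) != 0 by rewrite gt_eqF.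
have [_ hi] := cintegrable_cauchy yn0.
rewrite /stieltjes /cintegral [complex.Im (_ +i* _)]/= /Rintegral fineK; last exact: integrable_fin_num.
by apply: eq_integral => t _; rewrite /= sub0r sqrrN mulNr opprK.
Qed.

(** The resolvent identity, applied twice, expands the kernel at [z + h] to first order with
    remainder [h^2 G]. *)
Lemma stieltjes_cdiff z : 0 < complex.Im z ->
  cdiff (stieltjes sigma) z (cintegral sigma (fun t => (t%:C - z)^-1 * (t%:C - z)^-1)).
Proof.
move=> y0; set y := complex.Im z in y0.
pose V : R := fine (sigma setT).
have V0 : 0 <= V by rewrite fine_ge0.
have int_cst (r : R) : Rintegral sigma setT (fun=> r) = r * V by rewrite Rintegral_cst.
have yn0 : complex.Im z != 0 by rewrite gt_eqF.
have cm := cmeasurable_cauchy yn0.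
have k1 t : normc (t%:C - z)^-1 <= y^-1.
  by have := normc_cauchy t yn0; rewrite ger0_norm// ltW.
have ci := cintegrable_cauchy yn0.
have ci2 : cintegrable (fun t => (t%:C - z)^-1 * (t%:C - z)^-1).
  apply: (@cintegrable_bounded _ (y^-1 * y^-1)); first exact: cmeasurableM.
  by move=> t; rewrite Normc.normcM ler_pM ?normc_ge0.
move=> e e0.
(* For [normc h < y / 2] the point [z + h] stays above height [y / 2], so [2 / y^3] bounds [G]; the
   1 added to the mass keeps [K] positive for a null measure. *)
pose K : R := 2 * y^-1 * y^-1 * y^-1 * (V + 1).
have K0 : 0 < K by rewrite !mulr_gt0 ?invr_gt0// ltr_wpDl.
exists (Num.min (y / 2) (e / K)); first by rewrite lt_min !divr_gt0.
move=> h; rewrite lt_min => /andP[h1 h2].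
have yh : y / 2 < complex.Im (z + h).
  have := normc_Im h; rewrite raddfD /= -/y ler_norml => /andP[]; lra.
have yhn0 : complex.Im (z + h) != 0 by rewrite gt_eqF//; lra.
have cmh := cmeasurable_cauchy yhn0.
have k2 t : normc (t%:C - (z + h))^-1 <= 2 * y^-1.
  apply: le_trans (normc_cauchy t yhn0) _.
  rewrite ger0_norm; last by lra.
  have -> : 2 * y^-1 = (y / 2)^-1 by field; rewrite gt_eqF.
  by rewrite lef_pV2 ?posrE; lra.
pose G t := (t%:C - z)^-1 * ((t%:C - z)^-1 * (t%:C - (z + h))^-1).
have ciG : cintegrable G.
  apply: (@cintegrable_bounded _ (y^-1 * (y^-1 * (2 * y^-1)))).
    by apply: cmeasurableM => //; exact: cmeasurableM.
  move=> t; rewrite !Normc.normcM ler_pM ?mulr_ge0 ?normc_ge0//.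
  by rewrite ler_pM ?normc_ge0.
have nz (u : C) t : complex.Im u != 0 -> t%:C - u != 0.
  move=> u0; rewrite subr_eq0; apply/eqP => tu; move: u0; rewrite -tu /=.
  by rewrite eqxx.
have -> : stieltjes sigma (z + h) - stieltjes sigma z -
   cintegral sigma (fun t => (t%:C - z)^-1 * (t%:C - z)^-1) * h =
   h * (h * cintegral sigma G).
  rewrite -cintegralZ// -cintegralZ//; last exact: cintegrableZ.
  have E : (fun t => (t%:C - (z + h))^-1) =
     (fun t => (t%:C - z)^-1 + (h * ((t%:C - z)^-1 * (t%:C - z)^-1) + h * (h * G t))).
    apply/funext => t; rewrite /G.
    have n1 := nz z t yn0; have n2 := nz (z + h) t yhn0.
    by field; rewrite n1 n2.
  rewrite /stieltjes E cintegralD//; last first.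
    by apply: cintegrableD; do ?apply: cintegrableZ.
  rewrite cintegralD; [|exact: cintegrableZ|by do 2!apply: cintegrableZ].
  by rewrite cintegralZ//; ring.
rewrite !Normc.normcM [leRHS]mulrC ler_wpM2l ?normc_ge0//.
have GV : normc (cintegral sigma G) <= (y^-1 * (y^-1 * (2 * y^-1))) * V.
  rewrite -int_cst; apply: normc_cintegral => //; first exact: integrable_cst_finite.
  move=> t; rewrite !Normc.normcM ler_pM ?mulr_ge0 ?normc_ge0//.
  by rewrite ler_pM ?normc_ge0.
apply: (@le_trans _ _ (e / K * K)); last by rewrite divfK// gt_eqF.
apply: ler_pM; rewrite ?normc_ge0 ?(ltW h2)//.
apply: le_trans GV _; rewrite /K.
have -> : y^-1 * (y^-1 * (2 * y^-1)) * V = 2 * y^-1 * y^-1 * y^-1 * V by ring.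
by rewrite ler_wpM2l ?lerDl// !mulr_ge0 ?invr_ge0 ?ltW.
Qed.

End ComplexIntegral.

(** * From the imaginary part to the function *)

Section HerglotzTheorem.
Context {R : realType}.
Local Notation C := (R[i]).
Local Notation normc := Normc.normc.

(** The imaginary parts of [D * (i t)] and [D * t] are [t Re D] and [t Im D]; since [H] is real near
    [z], both are [o(t)]. *)
Lemma cdiff_real_eq0 (H : C -> C) (z D : C) (r : R) : 0 < r ->
  (forall h, normc h < r -> complex.Im (H (z + h)) = 0) -> cdiff H z D -> D = 0.
Proof.
move=> r0 Hr hD; apply/eqP; rewrite eq_complex /=.
have Hz : complex.Im (H z) = 0 by rewrite -[z]addr0; apply: Hr; rewrite Normc.normc0.
suff small (e : R) : 0 < e -> `|complex.Re D| <= e /\ `|complex.Im D| <= e.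
  by apply/andP; split; rewrite -normr_le0; apply/ler_addgt0Pl => e e0;
    rewrite addr0; have [] := small e e0.
move=> e0; have [d d0 hd] := hD e e0.
pose t : R := Num.min d r / 2.
have m0 : 0 < Num.min d r by rewrite lt_min d0.
have t0 : 0 < t by rewrite divr_gt0.
have tm : t < Num.min d r by rewrite ltr_pdivrMr// ltr_pMr// ltr1n.
have /andP[td tr] : (t < d) && (t < r) by rewrite -lt_min.
have key (h : C) : normc h = t -> `|complex.Im (D * h)| <= e * t.
  move=> ht; have := hd h (ltac:(by rewrite ht)); rewrite ht.
  apply: le_trans; apply: le_trans (normc_Im _).
  by rewrite !ImB Hr ?ht// Hz subrr sub0r normrN.
split.
  have n1 : normc (0 +i* t) = t by rewrite /= expr0n/= add0r sqrtr_sqr ger0_norm// ltW.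
  have := key _ n1; rewrite ImM /= mulr0 addr0 normrM [X in _ * X]ger0_norm ?(ltW t0)//.
  by rewrite ler_pM2r.
have n1 : normc (t +i* 0) = t by rewrite /= expr0n/= addr0 sqrtr_sqr ger0_norm// ltW.
have := key _ n1; rewrite ImM /= mulr0 add0r normrM [X in _ * X]ger0_norm ?(ltW t0)//.
by rewrite ler_pM2r.
Qed.

Lemma cdiff0_segment_const (H : C -> C) (p v : C) :
  (forall t : R, 0 <= t -> t <= 1 -> cdiff H (p + t%:C * v) 0) ->
  complex.Re (H (p + v)) = complex.Re (H p).
Proof.
move=> hc; pose g (t : R) : R := complex.Re (H (p + t%:C * v)).
have dg (t : R) : 0 <= t -> t <= 1 -> is_derive t 1 g 0.
  move=> t0 t1; have hd := hc t t0 t1.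
  have lim0 : h^-1 *: ((g \o shift t) (h *: 1) - g t) @[h --> 0^'] --> (0 : R).
    apply/cvgr0Pnorm_le => e e0.
    pose K : R := normc v + 1; have K0 : 0 < K by rewrite ltr_wpDl ?normc_ge0.
    have [d d0 hd'] := hd (e / K) (divr_gt0 e0 K0).
    apply/nbhs_ballP; exists (d / K); first by rewrite /= divr_gt0.
    move=> h; rewrite -ball_normE /= sub0r normrN => hdK h0.
    rewrite /GRing.scale /= mulr1 normrM normfV ler_pdivrMl ?normr_gt0//.
    have hv : normc (h%:C * v) <= `|h| * K.
      by rewrite Normc.normcM normc_real ler_wpM2l// lerDl.
    have hvd : normc (h%:C * v) < d by apply: le_lt_trans hv _; rewrite -ltr_pdivlMr.
    have := hd' _ hvd; rewrite mul0r subr0.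
    have -> : p + t%:C * v + h%:C * v = p + (h + t)%:C * v by rewrite rmorphD/=; ring.
    move=> hb; apply: le_trans (_ : e / K * (`|h| * K) <= _).
      apply: le_trans (le_trans hb _); last by rewrite ler_wpM2l// divr_ge0// ltW.
      by apply: le_trans (normc_Re _); rewrite ReB.
    by rewrite mulrCA divfK// gt_eqF.
  by apply: DeriveDef; [apply: cvgP lim0|apply/cvg_lim].
have [t||c _] := @MVT R g (fun=> 0) 0 1 ltr01.
- by rewrite in_itv/= => /andP[t0 t1]; apply: dg; exact: ltW.
- apply: continuous_in_subspaceT => t; rewrite inE/= in_itv/= => /andP[t0 t1].
  by apply/differentiable_continuous/derivable1_diffP; have [] := dg t t0 t1.
rewrite mul0r => /eqP; rewrite subr_eq0 /g => /eqP.
by rewrite rmorph1 rmorph0 mul1r mul0r addr0.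
Qed.

(** The difference [H] of the two functions is real-valued, so its derivative vanishes and its real
    part is constant on vertical rays. Both functions are [O(1 / Im z)], which makes that constant
    0. *)
Lemma herglotz (w : C -> C) (S : R) :
  (forall z : C, 0 < complex.Im z -> derivable (w : C^o -> C^o) z 1) ->
  (forall z : C, 0 < complex.Im z -> 0 <= complex.Im (w z)) ->
  (forall z : C, 0 < complex.Im z -> normc (w z) <= S / complex.Im z) ->
  exists sigma : {finite_measure set (measurableTypeR R) -> \bar R},
    forall z : C, 0 < complex.Im z -> w z = stieltjes sigma z.
Proof.
move=> wd wi wS; have [sigma hs] := herglotz_Im wd wi wS.
exists sigma.
pose H (z : C) := w z - stieltjes sigma z.
have HIm z : 0 < complex.Im z -> complex.Im (H z) = 0.
  move=> z0; have := poisson_stieltjes sigma (complex.Re z) z0.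
  rewrite hs// => -[]; rewrite /H ImB; case: (z) => a b /= ->.
  by rewrite subrr.
have Hd z : 0 < complex.Im z -> cdiff H z 0.
  move=> z0; have [D hD] := derivable_cdiff (wd z z0).
  have hHD := cdiffB hD (stieltjes_cdiff sigma z0).
  suff E0 : D - cintegral sigma (fun t => (t%:C - z)^-1 * (t%:C - z)^-1) = 0.
    by move: hHD; rewrite E0.
  apply: (cdiff_real_eq0 z0 _ hHD) => h hz; apply: HIm.
  by rewrite raddfD /=; have := normc_Im h; rewrite ler_norml => /andP[]; lra.
pose V : R := fine (sigma setT).
have V0 : 0 <= V by rewrite fine_ge0.
have Hb z : 0 < complex.Im z -> normc (H z) <= (`|S| + V) / complex.Im z.
  move=> z0; apply: le_trans (le_normcD _ _) _; rewrite normcN mulrDl lerD//.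
    by apply: le_trans (wS z z0) _; rewrite ler_wpM2r ?ler_norm// invr_ge0 ltW.
  have -> : V / complex.Im z = Rintegral sigma setT (fun=> (complex.Im z)^-1).
    by rewrite Rintegral_cst// mulrC.
  have yn0 : complex.Im z != 0 by rewrite gt_eqF.
  apply: normc_cintegral; [exact: cintegrable_cauchy|exact: integrable_cst_finite|].
  by move=> t; have := normc_cauchy t yn0; rewrite ger0_norm// ltW.
have Hconst z (s : R) : 0 < complex.Im z -> 0 <= s ->
    complex.Re (H (z + 0 +i* s)) = complex.Re (H z).
  move=> z0 s0; apply: cdiff0_segment_const => // t t0 t1; apply: Hd.
  by rewrite raddfD /= mul0r addr0 ltr_wpDr// mulr_ge0.
move=> z z0; apply/eqP; rewrite -subr_eq0 -/(H z) eq_complex /= HIm// eqxx andbT.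
rewrite -normr_le0; apply/ler_addgt0Pl => e e0; rewrite addr0.
have SV : 0 <= `|S| + V by rewrite addr_ge0.
pose s : R := (`|S| + V) / e.
have s0 : 0 <= s by rewrite divr_ge0// ltW.
rewrite -(Hconst z s z0 s0); apply: le_trans (normc_Re _) _.
have zs : 0 < complex.Im (z + 0 +i* s) by rewrite raddfD/= ltr_wpDr.
apply: le_trans (Hb _ zs) _; rewrite ler_pdivrMr// raddfD/= mulrDr.
by rewrite {1}/s [e * (_ / _)]mulrC divfK ?gt_eqF// lerDr mulr_ge0// ltW.
Qed.

End HerglotzTheorem.

(** * The fundamental matrix inequality *)

Section FundamentalMatrixInequality.
Local Open Scope sesquilinear_scope.

(** The entries [b_k], over an arbitrary ring: the identity below treats a variable and its
    conjugate as independent. *)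
Fixpoint moment_rem (K : pzRingType) (s : nat -> K) (w z : K) (k : nat) : K :=
  if k is k'.+1 then z * moment_rem s w z k' + s k' else w.

Lemma moment_remD (K : comPzRingType) (s : nat -> K) (w z : K) (k p : nat) :
  moment_rem s w z (k + p) =
    z ^+ p * moment_rem s w z k + \sum_(l < p) z ^+ (p.-1 - l) * s (k + l)%N.
Proof.
elim: p => [|p IH]; first by rewrite addn0 expr0 mul1r big_ord0 addr0.
rewrite addnS /= IH big_ord_recr /= subnn expr0 mul1r mulrDr addrA mulrA -exprS.
congr (_ + _ + _); rewrite mulr_sumr; apply: eq_bigr => -[l lp] _ /=.
by rewrite mulrA -exprS; congr (z ^+ _ * _); case: p lp {IH} => // p lp; rewrite subSn.
Qed.

Section Identity.
Variables (K : comPzRingType) (s : nat -> K) (w w' z z' d : K).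
Local Notation b := (moment_rem s w z).
Local Notation b' := (moment_rem s w' z').

(* With [w' = w^*], [z' = z^*] and [d = Im w / Im z] this is the value of the
   matrix form of the inequality at the vector
   [(z^m, z^(m-1), ..., 1, 0, ..., 0; z^(m+1))]. *)
Definition fmi_quad (m : nat) : K :=
  \sum_(k < m.+1) \sum_(l < m.+1) z' ^+ (m - k) * s (k + l)%N * z ^+ (m - l) +
  z ^+ m.+1 * \sum_(k < m.+1) z' ^+ (m - k) * b k +
  z' ^+ m.+1 * \sum_(k < m.+1) z ^+ (m - k) * b' k +
  z' ^+ m.+1 * z ^+ m.+1 * d.

Let rem_sum (u v : K) (m : nat) : u * moment_rem s v u (m.+1 + m.+1) =
  u ^+ m.+2 * moment_rem s v u m.+1 + \sum_(l < m.+1) u ^+ (m.+1 - l) * s (m.+1 + l)%N.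
Proof.
rewrite moment_remD mulrDr mulrA -exprS; congr (_ + _); rewrite mulr_sumr.
by apply: eq_bigr => -[l lm] _ /=; rewrite mulrA -exprS subSn.
Qed.

Let sum_step (u : K) (F : nat -> K) (m : nat) :
  \sum_(k < m.+2) u ^+ (m.+1 - k) * F k = u * (\sum_(k < m.+1) u ^+ (m - k) * F k) + F m.+1.
Proof.
rewrite big_ord_recr /= subnn expr0 mul1r mulr_sumr; congr (_ + _).
by apply: eq_bigr => -[k km] _ /=; rewrite mulrA -exprS subSn.
Qed.

(** The test vector is multiplied by [z] and receives a new entry 1. The old form is thus multiplied
    by [z' z], and the cross terms with the new entry assemble, by [rem_sum], into [z b_(2m+2)] and
    its conjugate. *)
Lemma fmi_quadS (m : nat) : fmi_quad m.+1 = z' * z * fmi_quad m +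
  z * b (m.+1 + m.+1) + z' * b' (m.+1 + m.+1) + s (m.+1 + m.+1)%N.
Proof.
rewrite /fmi_quad !sum_step !rem_sum.
have -> : \sum_(k < m.+2) \sum_(l < m.+2) z' ^+ (m.+1 - k) * s (k + l)%N * z ^+ (m.+1 - l) =
  z' * z * (\sum_(k < m.+1) \sum_(l < m.+1) z' ^+ (m - k) * s (k + l)%N * z ^+ (m - l)) +
  \sum_(l < m.+1) z' ^+ (m.+1 - l) * s (m.+1 + l)%N +
  \sum_(l < m.+1) z ^+ (m.+1 - l) * s (m.+1 + l)%N + s (m.+1 + m.+1)%N.
  under eq_bigr => k _.
    rewrite (_ : \sum_(l < m.+2) _ = z' ^+ (m.+1 - k) *
       (z * (\sum_(l < m.+1) z ^+ (m - l) * s (k + l)%N) + s (k + m.+1)%N)); last first.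
      rewrite -(sum_step z (fun l => s (k + l)%N)) mulr_sumr.
      by apply: eq_bigr => l _; rewrite -mulrA [s _ * _]mulrC.
    over.
  rewrite (sum_step z' (fun k => z * (\sum_(l < m.+1) z ^+ (m - l) * s (k + l)%N) + s (k + m.+1)%N)).
  under eq_bigr do rewrite mulrDr.
  rewrite big_split /= mulrDr -!addrA; congr (_ + (_ + (_ + _))).
  - rewrite -mulrA; congr (_ * _); rewrite mulr_sumr; apply: eq_bigr => k _.
    rewrite mulrCA; congr (_ * _); rewrite mulr_sumr; apply: eq_bigr => l _.
    by rewrite -mulrA [s _ * _]mulrC.
  - rewrite mulr_sumr; apply: eq_bigr => -[k km] _ /=.
    by rewrite mulrA -exprS subSn// addnC.
  - rewrite mulr_sumr; apply: eq_bigr => -[l lm] _ /=.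
    by rewrite mulrA -exprS subSn.
rewrite !exprS; ring.
Qed.

(** For conjugate variables this evaluates the quadratic form as [Im (z b_(2m+1)) / Im z], with
    denominators cleared. *)
Lemma fmi_quadE (m : nat) : (z - z') * d = w - w' ->
  (z - z') * fmi_quad m = z * b (m.*2.+1) - z' * b' (m.*2.+1).
Proof.
move=> hd; elim: m => [|m IH].
  rewrite /fmi_quad !big_ord_recl !big_ord0 /= !addr0 !expr0 !expr1 !mul1r !mulr1.
  have -> : (z - z') * (s 0%N + z * w + z' * w' + z' * z * d) =
    (z - z') * (s 0%N + z * w + z' * w') + z' * z * ((z - z') * d) by ring.
  by rewrite hd; ring.
have e2 : (m.+1 + m.+1)%N = m.*2.+2 by rewrite addnn.
rewrite fmi_quadS doubleS e2 /=.
have -> (x y t u : K) : (z - z') * (z' * z * x + y + t + u) =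
  z' * z * ((z - z') * x) + (z - z') * (y + t + u) by ring.
by rewrite IH /=; ring.
Qed.

End Identity.

Context {R : realType}.
Local Notation C := (R[i]).
Local Notation normc := Normc.normc.
Implicit Types (s : nat -> R) (w : C -> C) (z : C).

Lemma conjCE z : (z^*)%R = complex.Re z +i* (- complex.Im z).
Proof. by case: z. Qed.

Definition cseq s : nat -> C := fun k => (s k)%:C.

Lemma conj_moment_rem s (v z : C) k :
  ((moment_rem (cseq s) v z k)^*)%R = moment_rem (cseq s) (v^*)%R (z^*)%R k.
Proof.
elim: k => //= k IH; rewrite rmorphD rmorphM /= IH; congr (_ + _).
by rewrite conjCE /= oppr0.
Qed.

Lemma fmi_B_rem n s w z (k : 'I_n.+1) : fmi_B n s w z k 0 = moment_rem (cseq s) (w z) z k.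
Proof. by rewrite fmi_BE -[X in moment_rem _ _ _ X]add0n moment_remD. Qed.

Lemma fmi_quad_form n s w z (X : nat -> C) (c : C) : psdmx (fmi_mx n s w z) ->
  0 <= \sum_(k < n.+1) \sum_(l < n.+1) (X k)^* * (s (k + l)%N)%:C * X l +
       c * (\sum_(k < n.+1) (X k)^* * moment_rem (cseq s) (w z) z k) +
       c^* * (\sum_(k < n.+1) X k * (moment_rem (cseq s) (w z) z k)^*) +
       c^* * c * ((w z - (w z)^*) / (z - z^*)).
Proof.
move=> [_ /(_ (col_mx (\col_k X k) (c%:M)))].
rewrite /fmi_mx tr_col_mx map_row_mx mul_row_block mul_row_col.
rewrite tr_scalar_mx map_scalar_mx !mul_scalar_mx !mulmxDl !mul_mx_scalar -!scalemxAl.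
move=> h; apply: (eq_ind _ (fun r => 0 <= r) h); rewrite !mxE -!addrA.
congr (_ + _).
  rewrite exchange_big /=; apply: eq_bigr => l _; rewrite !mxE mulr_suml.
  by apply: eq_bigr => k _; rewrite !mxE.
rewrite addrCA; congr (_ + (_ + _)).
- by congr (_ * _); apply: eq_bigr => k _; rewrite fmi_B_rem !mxE.
- by congr (_ * _); apply: eq_bigr => k _; rewrite -fmi_B_rem [LHS]mulrC; congr (_ * _); rewrite ?mxE.
- by rewrite mulr1n mulrA [c * _]mulrC.
Qed.

Lemma subr_conj z : z - z^* = (2 * complex.Im z)%:C * 'i%C.
Proof.
rewrite conjCE; case: z => x y /=; apply/eqP; rewrite eq_complex /=.
by apply/andP; split; apply/eqP; ring.
Qed.

Lemma divr_conj (v z : C) : complex.Im z != 0 -> (v - v^*) / (z - z^*) = (complex.Im v / complex.Im z)%:C.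
Proof.
move=> y0; rewrite !subr_conj; apply/eqP.
have n0 : (2 * complex.Im z)%:C * 'i%C != 0 :> C.
  by rewrite eq_complex /= !mul0r !mulr0 !mulr1 subrr addr0 eqxx /= mulf_neq0// pnatr_eq0.
rewrite -subr_eq0 -(mulIr_eq0 _ (mulIf n0)) mulrBl divfK// subr_eq0.
by rewrite eq_complex /=; apply/andP; split; apply/eqP; field.
Qed.

(** * Positivity and growth drawn from the matrix inequality *)

Section Consequences.
Variables (n : nat) (s : nat -> R) (w : C -> C).
Hypothesis hfmi : forall z, 0 < complex.Im z -> psdmx (fmi_mx n s w z).
Local Notation b z := (moment_rem (cseq s) (w z) z).

(** The matrix is tested on the vector of [fmi_quad], whose entries beyond [m] are 0, and
    [fmi_quadE] evaluates the result. *)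
Lemma fmi_Im_ge0 (m : nat) z : (m <= n)%N -> 0 < complex.Im z ->
  0 <= complex.Im (z * b z m.*2.+1).
Proof.
move=> mn y0; have yn0 : complex.Im z != 0 by rewrite gt_eqF.
pose X k := if (k <= m)%N then z ^+ (m - k) else 0 : C.
have wid (F : nat -> C) : (forall k, (m < k)%N -> F k = 0) ->
    \sum_(k < n.+1) F k = \sum_(k < m.+1) F k.
  move=> F0; rewrite [RHS](big_ord_widen n.+1 F) ?ltnS//.
  rewrite [LHS](bigID (fun k : 'I_n.+1 => (k < m.+1)%N)) /= [X in _ + X]big1 ?addr0// => k.
  by rewrite -leqNgt => /F0.
have X0 k : (m < k)%N -> X k = 0 by rewrite /X ltnNge => /negbTE ->.
have Xk (k : 'I_m.+1) : X k = z ^+ (m - k) by rewrite /X -ltnS ltn_ord.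
have := fmi_quad_form X (z ^+ m.+1) (hfmi y0); rewrite divr_conj//.
set q := (X in 0 <= X -> _) => q0.
have qE : q = fmi_quad (cseq s) (w z) (w z)^* z z^* (complex.Im (w z) / complex.Im z)%:C m.
  rewrite /q /fmi_quad rmorphXn /=; congr (_ + _ * _ + _ * _ + _).
  - rewrite (wid (fun k => \sum_(l < n.+1) (X k)^* * (s (k + l)%N)%:C * X l)); last first.
      by move=> k /X0 ->; rewrite big1// => l _; rewrite rmorph0 !mul0r.
    apply: eq_bigr => k _; rewrite (wid (fun l => (X k)^* * (s (k + l)%N)%:C * X l)); last first.
      by move=> l /X0 ->; rewrite mulr0.
    by apply: eq_bigr => l _; rewrite !Xk rmorphXn.
  - rewrite (wid (fun k => (X k)^* * b z k)); last by move=> k /X0 ->; rewrite rmorph0 mul0r.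
    by apply: eq_bigr => k _; rewrite Xk rmorphXn.
  - rewrite (wid (fun k => X k * (b z k)^*)); last by move=> k /X0 ->; rewrite mul0r.
    by apply: eq_bigr => k _; rewrite Xk conj_moment_rem.
have zJ0 : z - z^* != 0.
  by rewrite subr_conj eq_complex /= !mul0r !mulr0 !mulr1 subrr addr0 eqxx /= mulf_neq0// pnatr_eq0.
have := @fmi_quadE _ (cseq s) (w z) (w z)^* z z^* (complex.Im (w z) / complex.Im z)%:C m.
rewrite -qE -divr_conj// mulrCA divff// mulr1 => /(_ erefl).
rewrite -conj_moment_rem -rmorphM => qq.
have : q = (complex.Im (z * b z m.*2.+1) / complex.Im z)%:C.
  by rewrite -divr_conj// -qq mulrAC divff// mul1r.
move=> qE'; move: q0; rewrite qE' ler0c pmulr_lge0// invr_gt0//.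
Qed.

(** The vector [(a, 0, ..., 0; c)], which tests the corner submatrix with entries [s_0], [w z], its
    conjugate and [Im (w z) / Im z]. *)
Let quad0 z (a c : C) : 0 < complex.Im z ->
  0 <= a^* * (s 0%N)%:C * a + c * (a^* * w z) + c^* * (a * (w z)^*) +
       c^* * c * (complex.Im (w z) / complex.Im z)%:C.
Proof.
move=> y0; have yn0 : complex.Im z != 0 by rewrite gt_eqF.
have sum0 (F : nat -> C) : (forall k, F k.+1 = 0) -> \sum_(k < n.+1) F k = F 0%N.
  by move=> F0; rewrite big_ord_recl big1 ?addr0// => i _; rewrite F0.
pose X k : C := if k is 0%N then a else 0.
have := fmi_quad_form X c (hfmi y0); rewrite divr_conj//.
rewrite (sum0 (fun k => \sum_(l < n.+1) (X k)^* * (s (k + l)%N)%:C * X l)); last first.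
  by move=> k; rewrite big1// => l _; rewrite rmorph0 !mul0r.
rewrite (sum0 (fun l => (X 0%N)^* * (s (0 + l)%N)%:C * X l)); last by move=> k; rewrite mulr0.
rewrite (sum0 (fun k => (X k)^* * b z k)); last by move=> k; rewrite rmorph0 mul0r.
by rewrite (sum0 (fun k => X k * (b z k)^*)); last by move=> k; rewrite mul0r.
Qed.

Lemma fmi_normc z : 0 < complex.Im z -> normc (w z) <= s 0%N / complex.Im z.
Proof.
move=> y0; set y := complex.Im z in y0 *; have yn0 : complex.Im z != 0 by rewrite gt_eqF.
have [w0|wn0] := eqVneq (w z) 0.
  have := quad0 1 0 y0.
  rewrite w0 Normc.normc0 !mul0r !addr0 rmorph0 !mul0r !addr0 rmorph1 mul1r mulr1 ler0c => s0.
  by rewrite divr_ge0// ltW.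
set N := normc (w z); have N0 : 0 < N by rewrite normc_gt0.
(* The phase of [w z] with modulus [1 / y]: together with [c = -1] it makes both cross terms equal
   to [- N / y], giving [2 N / y <= s_0 / y^2 + Im (w z) / y]. Then [Im (w z) <= N] finishes. *)
pose a : C := w z * (N * y)^-1%:C.
have aJ : a^* = (w z)^* * (N * y)^-1%:C.
  by rewrite /a rmorphM; congr (_ * _); apply: (etrans (conjCE _)); rewrite /= oppr0.
have wN : w z * (w z)^* = (N ^+ 2)%:C.
  rewrite normc_sqr conjCE; case: (w z) => p q /=; apply/eqP; rewrite eq_complex /=.
  by apply/andP; split; apply/eqP; ring.
have := quad0 a (-1) y0.
rewrite rmorphN rmorph1 mulrNN mulr1 mul1r !mulN1r.
have -> : a^* * (s 0%N)%:C * a = (s 0%N / y ^+ 2)%:C.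
  rewrite aJ /a.
  have -> : (w z)^* * (N * y)^-1%:C * (s 0%N)%:C * (w z * (N * y)^-1%:C) =
     (w z * (w z)^*) * ((N * y)^-1%:C * (s 0%N)%:C * (N * y)^-1%:C) by ring.
  rewrite wN -!rmorphM/=; congr (_%:C); field.
  by rewrite !gt_eqF.
have -> : a^* * w z = (N / y)%:C.
  rewrite aJ mulrAC [_^* * _]mulrC wN -rmorphM/=; congr (_%:C); field.
  by rewrite !gt_eqF.
have -> : a * (w z)^* = (N / y)%:C.
  rewrite /a mulrAC wN -rmorphM/=; congr (_%:C); field.
  by rewrite !gt_eqF.
rewrite -!rmorphN -!rmorphD /= ler0c => h.
have := ler_norm (complex.Im (w z)); have := normc_Im (w z); rewrite -/N => h1 h2.
have h3 : complex.Im (w z) / y <= N / y by rewrite ler_wpM2r ?invr_ge0 ?(ltW y0)//; lra.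
have h4 : N / y <= s 0%N / y ^+ 2 by rewrite -/y in h; lra.
have -> : s 0%N / y = (s 0%N / y ^+ 2) * y by field; rewrite gt_eqF.
by rewrite -ler_pdivrMr.
Qed.

End Consequences.

End FundamentalMatrixInequality.

(** * Moments *)

Section Moments.
Context {R : realType}.
Local Notation C := (R[i]).
Local Notation normc := Normc.normc.

Section MomentIntegrals.
Variable sigma : {finite_measure set (measurableTypeR R) -> \bar R}.

Lemma measurable_monomial (k : nat) : measurable_fun setT (fun t : R => t ^+ k).
Proof. by apply: measurable_funX. Qed.

Lemma has_moment_le (k m : nat) : (k <= m.*2)%N -> has_moment sigma m.*2 -> has_moment sigma k.
Proof.
move=> km hm.
have h1 : sigma.-integrable setT (EFin \o (fun t : R => 1 + t ^+ m.*2)).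
  rewrite (_ : _ \o _ = (fun t : R => 1%:E + (t ^+ m.*2)%:E)%E)//.
  by apply: integrableD => //; exact: integrable_cst_finite.
apply: (le_integrable _ _ _ h1) => //.
  by apply/measurable_EFinP; exact: measurable_monomial.
move=> t _; rewrite !abse_EFin lee_fin normrX.
have t2 : t ^+ m.*2 = `|t| ^+ m.*2.
  by rewrite -mul2n !exprM real_normK ?num_real.
rewrite t2 (ger0_norm (x := 1 + _)) ?addr_ge0 ?exprn_ge0//.
have [t1|t1] := leP `|t| 1.
  by apply: (@le_trans _ _ 1); [rewrite exprn_ile1|rewrite lerDl exprn_ge0].
apply: le_trans (_ : `|t| ^+ m.*2 <= _); last by rewrite lerDr.
by rewrite ler_weXn2l// ltW.
Qed.

Definition moment_cauchy (k : nat) (z : C) : C :=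
  cintegral sigma (fun t => (t ^+ k)%:C * (t%:C - z)^-1).

Lemma has_moment_norm k : has_moment sigma k ->
  sigma.-integrable setT (EFin \o (fun t : R => `|t ^+ k|)).
Proof.
move=> hk; rewrite (_ : _ \o _ = (fun t : R => `|(t ^+ k)%:E|)%E)//.
exact: integrable_abse.
Qed.

Let dom (k : nat) (z : C) (t : R) : complex.Im z != 0 ->
  normc ((t ^+ k)%:C * (t%:C - z)^-1) <= `|complex.Im z|^-1 * `|t ^+ k|.
Proof.
move=> y0; rewrite Normc.normcM normc_real mulrC ler_wpM2r//.
exact: normc_cauchy.
Qed.

Lemma cintegrable_moment_cauchy (k : nat) (z : C) : complex.Im z != 0 -> has_moment sigma k ->
  cintegrable sigma (fun t => (t ^+ k)%:C * (t%:C - z)^-1).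
Proof.
move=> y0 hk; apply: (@cintegrable_dom _ _ _ (fun t => `|complex.Im z|^-1 * `|t ^+ k|)).
- apply: cmeasurableM; last exact: cmeasurable_cauchy.
  by apply: cmeasurable_real; exact: measurable_monomial.
- rewrite (_ : _ \o _ = (fun t : R => (`|complex.Im z|^-1)%:E * (`|t ^+ k|)%:E)%E)//.
  by apply: integrableZl => //; exact: has_moment_norm.
- by move=> t; exact: dom.
Qed.

Lemma normc_moment_cauchy (m : nat) (z : C) : complex.Im z != 0 -> has_moment sigma m.*2 ->
  normc (moment_cauchy m.*2 z) <= moment sigma m.*2 / `|complex.Im z|.
Proof.
move=> y0 hk.
have -> : moment sigma m.*2 / `|complex.Im z| =
  Rintegral sigma setT (fun t => `|complex.Im z|^-1 * `|t ^+ m.*2|).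
  rewrite RintegralZl//; last exact: has_moment_norm.
  rewrite mulrC /moment; congr (_ * _); apply: eq_Rintegral => t _.
  by rewrite ger0_norm// -mul2n exprM exprn_ge0// sqr_ge0.
apply: normc_cintegral; first exact: cintegrable_moment_cauchy.
- rewrite (_ : _ \o _ = (fun t : R => (`|complex.Im z|^-1)%:E * (`|t ^+ m.*2|)%:E)%E)//.
  by apply: integrableZl => //; exact: has_moment_norm.
- by move=> t; exact: dom.
Qed.

(** From [t / (t - z) = 1 + z / (t - z)]. This is the recursion of [moment_rem] with the moments of
    [sigma] as data, and it reaches index [k + 1] from integrability of [t^k]. *)
Lemma moment_cauchyS (k : nat) (z : C) : complex.Im z != 0 -> has_moment sigma k ->
  moment_cauchy k.+1 z = z * moment_cauchy k z + (moment sigma k)%:C.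
Proof.
move=> y0 hk; rewrite /moment_cauchy /moment -cintegral_real -cintegralZ; last exact: cintegrable_moment_cauchy.
rewrite -cintegralD.
- congr cintegral; apply/funext => t.
  have n0 : t%:C - z != 0.
    by rewrite subr_eq0; apply/eqP => tz; move: y0; rewrite -tz /= eqxx.
  by rewrite exprS rmorphM /=; field.
- by apply: cintegrableZ; exact: cintegrable_moment_cauchy.
- split => //=; rewrite (_ : _ \o _ = cst 0%E)//; exact: integrable0.
Qed.

Lemma moment_rem_cauchy (s : nat -> R) (k : nat) (z : C) : complex.Im z != 0 ->
  (forall j, (j < k)%N -> has_moment sigma j /\ moment sigma j = s j) ->
  moment_rem (cseq s) (stieltjes sigma z) z k = moment_cauchy k z.
Proof.
move=> y0; elim: k => [_|k IH hk] /=.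
  by rewrite /stieltjes /moment_cauchy; congr cintegral; apply/funext => t; rewrite expr0 mul1r.
rewrite IH; last by move=> j jk; apply: hk; exact: ltnW.
by have [h1 h2] := hk k (leqnn _); rewrite moment_cauchyS// h2.
Qed.

End MomentIntegrals.

(** * Moments of the representing measure, by induction *)

Section FMIMoments.
Variable sigma : {finite_measure set (measurableTypeR R) -> \bar R}.
Variables (n : nat) (s : nat -> R) (w : C -> C).
Hypothesis hfmi : forall z : C, 0 < complex.Im z -> psdmx (fmi_mx n s w z).
Hypothesis wE : forall z : C, 0 < complex.Im z -> w z = stieltjes sigma z.
Local Notation M := (moment sigma).
Local Notation J := (moment_cauchy sigma).

Let moments_ok m := [/\ has_moment sigma m.*2,
  forall j, (j < m.*2)%N -> M j = s j & M m.*2 <= s m.*2].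

(** Pointwise, [t^2 N^2 / (t^2 + N^2) = N^2 - N^4 / (t^2 + N^2)], and the last fraction is
    [N^3 Im (t - iN)^-1]. The moment of order [2m + 2], not yet known to exist, is thus approached
    through quantities of order [2m]. *)
Let cutoff_int m (N : R) : 0 < N -> has_moment sigma m.*2 ->
  (\int[sigma]_t (t ^+ m.*2.+2 * (N ^+ 2 / (t ^+ 2 + N ^+ 2)))%:E =
    (N ^+ 2 * M m.*2 - N ^+ 3 * complex.Im (J m.*2 (0 +i* N)))%:E)%E.
Proof.
move=> N0 hm; have y0 : complex.Im (0 +i* N) != 0 by rewrite gt_eqF.
have [_ hi] := cintegrable_moment_cauchy y0 hm.
have -> : complex.Im (J m.*2 (0 +i* N)) = Rintegral sigma setT
  (fun t : R => complex.Im ((t ^+ m.*2)%:C * (t%:C - (0 +i* N))^-1)) by [].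
move: hi; set f := (fun t : R => complex.Im _) => hi.
have i1 : sigma.-integrable setT (fun t : R => (N ^+ 2)%:E * (t ^+ m.*2)%:E)%E.
  exact: integrableZl.
have i2 : sigma.-integrable setT (fun t : R => (N ^+ 3)%:E * (f t)%:E)%E.
  exact: integrableZl.
rewrite EFinB !EFinM /moment /Rintegral.
rewrite !fineK; [|exact: integrable_fin_num|exact: integrable_fin_num].
rewrite -!integralZl// -integralB//.
apply: eq_integral => t _.
rewrite -!EFinM -EFinB; congr EFin; rewrite /f cauchy_kernelE ImM /= subr0 mul0r addr0.
have d0 : 0 < t ^+ 2 + N ^+ 2 by rewrite ltr_wpDl ?sqr_ge0 ?exprn_gt0.
by rewrite !exprS; field; rewrite gt_eqF.
Qed.

(** With [b_1 = z w + s_0] at [z = iN], positivity says [N Im (w (iN)) <= s_0], a bound on the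
    cut-off mass. *)
Let moment0 : moments_ok 0.
Proof.
have h0 : has_moment sigma 0.*2.
  rewrite /has_moment; under eq_fun do rewrite expr0; exact: integrable_cst_finite.
split => //.
have : (\int[sigma]_t ((fun t => t ^+ 0) t : R)%:E <= (s 0%N)%:E)%E.
  apply: integral_le_of_cutoff => [|t|k]; [exact: measurable_monomial|by rewrite expr0|].
  have N0 : 0 < k.+1%:R :> R by [].
  move: (k.+1%:R : R) N0 => N N0.
  have y0 : complex.Im (0 +i* N) != 0 by rewrite gt_eqF.
  have [_ hi] := cintegrable_moment_cauchy y0 h0.
  have := fmi_Im_ge0 hfmi (leq0n n) (z := 0 +i* N) N0; rewrite /= wE//.
  have -> : stieltjes sigma (0 +i* N) = J 0.*2 (0 +i* N).
    by rewrite /stieltjes /moment_cauchy; congr cintegral; apply/funext => t; rewrite expr0 mul1r.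
  have JE : complex.Im (J 0.*2 (0 +i* N)) = Rintegral sigma setT
    (fun t : R => complex.Im ((t ^+ 0.*2)%:C * (t%:C - (0 +i* N))^-1)) by [].
  move: hi JE; set f := (fun t : R => complex.Im _) => hi JE h.
  have -> : (\int[sigma]_t (t ^+ 0 * (N ^+ 2 / (t ^+ 2 + N ^+ 2)))%:E =
     (N * complex.Im (J 0.*2 (0 +i* N)))%:E)%E.
    rewrite JE EFinM /Rintegral fineK; last exact: integrable_fin_num.
    rewrite -integralZl//; apply: eq_integral => t _.
    rewrite -EFinM; congr EFin; rewrite /f cauchy_kernelE ImM /= subr0.
    have d0 : 0 < t ^+ 2 + N ^+ 2 by rewrite ltr_wpDl ?sqr_ge0 ?exprn_gt0.
    by rewrite expr0; field; rewrite gt_eqF.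
  rewrite lee_fin; move: h; case: (J 0.*2 (0 +i* N)) => p q /= h.
  have : 0 <= N * (s 0%N - N * q) by apply: le_trans h _; rewrite le_eqVlt; apply/orP; left; apply/eqP; ring.
  by rewrite pmulr_rge0// subr_ge0.
rewrite -[X in (X <= _)%E]fineK; last exact: integrable_fin_num.
by rewrite lee_fin.
Qed.

(* At [z = iN], [Im (z b_(2m+3) z) >= 0] bounds the cut-off moment of order
   [2m+2] by [s_(2m+2) - N^2 (s_(2m) - M_(2m))]; at [z = r (c + i)] with
   [c = 1] or [c = -1], letting [r] grow forces [M_(2m+1) = s_(2m+1)]. *)
Let step m : (m < n)%N -> moments_ok m -> moments_ok m.+1.
Proof.
move=> mn [hm eqm lem].
have remE (z : C) : 0 < complex.Im z -> moment_rem (cseq s) (w z) z m.*2 = J m.*2 z.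
  move=> z0; rewrite wE//; apply: moment_rem_cauchy; first by rewrite gt_eqF.
  by move=> j jm; split; [apply: (has_moment_le (ltnW jm))|apply: eqm].
have g0 (z : C) : 0 < complex.Im z -> 0 <= complex.Im (z * (z * (z * (z * J m.*2 z + (s m.*2)%:C)
     + (s m.*2.+1)%:C) + (s m.*2.+2)%:C)).
  by move=> z0; have := fmi_Im_ge0 hfmi mn z0; rewrite doubleS /= remE.
have main (N : R) : 0 < N -> N ^+ 2 * M m.*2 - N ^+ 3 * complex.Im (J m.*2 (0 +i* N)) <=
   s m.*2.+2 - N ^+ 2 * (s m.*2 - M m.*2).
  move=> N0; have := g0 (0 +i* N) N0.
  case: (J m.*2 (0 +i* N)) => p q h.
  have : 0 <= N * (N ^+ 3 * q - N ^+ 2 * s m.*2 + s m.*2.+2).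
    apply: le_trans h _; rewrite le_eqVlt; apply/orP; left; apply/eqP => /=; ring.
  by rewrite pmulr_rge0// [complex.Im _]/=; lra.
have t0 (t : R) : 0 <= t ^+ m.*2.+2 by rewrite -doubleS -mul2n exprM exprn_ge0// sqr_ge0.
have cut (N : R) : 0 < N -> (\int[sigma]_t (t ^+ m.*2.+2 * (N ^+ 2 / (t ^+ 2 + N ^+ 2)))%:E <=
    (s m.*2.+2 - N ^+ 2 * (s m.*2 - M m.*2))%:E)%E.
  by move=> N0; rewrite cutoff_int// lee_fin main.
have int_le : (\int[sigma]_t ((fun t : R => t ^+ m.*2.+2) t)%:E <= (s m.*2.+2)%:E)%E.
  apply: integral_le_of_cutoff => [|//|k]; first exact: measurable_monomial.
  by apply: le_trans (cut _ (ltr0Sn _ k)) _; rewrite lee_fin gerBl mulr_ge0 ?sqr_ge0// subr_ge0.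
have hm2 : has_moment sigma m.+1.*2.
  apply/integrableP; split; first by apply/measurable_EFinP; exact: measurable_monomial.
  under eq_integral => t _ do rewrite doubleS abse_EFin ger0_norm//.
  by apply: le_lt_trans int_le _; rewrite ltry.
have le2 : M m.*2.+2 <= s m.*2.+2.
  by rewrite -lee_fin /moment /Rintegral fineK//; exact: integrable_fin_num.
have eq2 : M m.*2 = s m.*2.
  apply/eqP; rewrite eq_le lem /= leNgt; apply/negP => lt.
  have d0 : 0 < s m.*2 - M m.*2 by rewrite subr_gt0.
  have s0 : 0 <= s m.*2.+2.
    by rewrite -lee_fin; apply: le_trans int_le; apply: integral_ge0 => t _; rewrite lee_fin.
  (* With [D = s_(2m) - M_(2m) > 0] this gives [N D = D + s_(2m+2)], and [N >= 1]; hence [N^2 D]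
     exceeds [s_(2m+2)] and the cut-off bound would be negative. *)
  pose N := 1 + s m.*2.+2 / (s m.*2 - M m.*2).
  have N1 : 1 <= N by rewrite lerDl divr_ge0// ltW.
  have N0 : 0 < N by lra.
  have : 0 <= s m.*2.+2 - N ^+ 2 * (s m.*2 - M m.*2).
    rewrite -lee_fin; apply: le_trans (cut _ N0); apply: integral_ge0 => t _.
    by rewrite lee_fin mulr_ge0// divr_ge0 ?addr_ge0 ?sqr_ge0.
  have : N * (s m.*2 - M m.*2) = s m.*2 - M m.*2 + s m.*2.+2.
    by rewrite /N mulrDl mul1r divfK// gt_eqF.
  have : N * (s m.*2 - M m.*2) <= N ^+ 2 * (s m.*2 - M m.*2).
    by rewrite ler_wpM2r ?(ltW d0)// expr2 ler_peMl// ltW.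
  lra.
have hm1 : has_moment sigma m.*2.+1 by apply: (has_moment_le (m := m.+1)) => //; rewrite doubleS.
(* Since [c^2 = 1], [z^2 = 2 i c r^2], so the imaginary part of [z^2 (K + s_(2m+1)) + z s_(2m+2)]
   involves only the real part of [K]. Here [K + M_(2m+1)] is the Cauchy integral of order [2m + 2],
   of modulus at most [M_(2m+2) / r]. *)
have bound (c r : R) : `|c| = 1 -> 0 < r ->
   0 <= 2 * M m.*2.+2 + s m.*2.+2 + 2 * c * r * (s m.*2.+1 - M m.*2.+1).
  move=> c1 r0; pose z : C := (c * r) +i* r.
  have z0 : 0 < complex.Im z by [].
  have zn0 : complex.Im z != 0 by rewrite gt_eqF.
  have := g0 z z0; have := normc_moment_cauchy (m := m.+1) zn0 hm2.
  rewrite doubleS !moment_cauchyS// eq2 [complex.Im z]/= (gtr0_norm r0).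
  set K := z * (z * J m.*2 z + _) => hK h.
  have h1 := normc_Re (K + (M m.*2.+1)%:C).
  move: (normc _) hK h h1 => B; case: K => p q.
  rewrite ler_pdivlMr// => hK h; rewrite [complex.Re _]/= => h1.
  have c2 : c ^+ 2 = 1 by rewrite -real_normK ?num_real// c1 expr1n.
  have : 0 <= r * (2 * (c * (r * (p + s m.*2.+1))) + s m.*2.+2).
    apply: le_trans h _; rewrite /z /= le_eqVlt -subr_eq0.
    rewrite (_ : _ - _ = (c ^+ 2 - 1) * (r ^+ 2 * q)); last by ring.
    by rewrite c2 subrr mul0r eqxx.
  rewrite pmulr_rge0// => h'.
  have h3 : c * (r * (p + M m.*2.+1)) <= M m.*2.+2.
    apply: le_trans (ler_norm _) _; rewrite normrM c1 mul1r normrM (gtr0_norm r0) mulrC.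
    by apply: le_trans hK; rewrite ler_wpM2r// ltW.
  lra.
have eq1 : M m.*2.+1 = s m.*2.+1.
  have b0 : 0 <= 2 * M m.*2.+2 + s m.*2.+2.
    have := bound 1 1 (normr1 _) ltr01; have := bound (-1) 1 (normrN1 _) ltr01; lra.
  apply/esym/eqP; rewrite -subr_eq0; move: bound b0.
  set K := _ + _; set e := _ - _ => bound b0; apply/negPn/negP => e0.
  (* With [c] of sign opposite to [e], [bound] would read [0 <= K - 2 (K + 1)], which is impossible
     for [K >= 0]. *)
  pose r := (K + 1) / `|e|.
  have ne : 0 < `|e| by rewrite normr_gt0.
  have r0 : 0 < r by rewrite divr_gt0//; lra.
  have re : r * `|e| = K + 1 by rewrite divfK// gt_eqF.
  have := bound (- Num.sg e) r _ r0; rewrite normrN normr_sg e0 => /(_ erefl).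
  have -> : 2 * - Num.sg e * r * e = - 2 * (r * (Num.sg e * e)) by ring.
  by rewrite -normrEsg re; lra.
split => //; rewrite doubleS // => j.
rewrite ltnS leq_eqVlt => /orP[/eqP->//|].
by rewrite ltnS leq_eqVlt => /orP[/eqP->//|]; exact: eqm.
Qed.

Lemma fmi_moments :
  [/\ forall k : nat, (k <= n.*2)%N -> has_moment sigma k,
      forall k : nat, (k < n.*2)%N -> M k = s k & M n.*2 <= s n.*2].
Proof.
have [h1 h2 h3] : moments_ok n.
  have : (n <= n)%N by []. move: {-2}n; elim=> [_|m IH mn]; first exact: moment0.
  by apply: step => //; apply: IH; exact: ltnW.
by split => // k kn; exact: has_moment_le h1.
Qed.

End FMIMoments.
End Moments.

(** * Uniqueness *)

Section StieltjesInversion.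
Context {R : realType}.
Local Notation C := (R[i]).
Local Notation mu := (@lebesgue_measure R).

(** The integral of [poisson x y t] over [x] in [[a, b]]: [pi] times the indicator of the interval,
    smoothed at scale [y]. *)
Definition atan_window (y a b t : R) : R := atan ((b - t) / y) - atan ((a - t) / y).

Lemma continuous_atan_window (y a b : R) : continuous (atan_window y a b).
Proof.
have h (c : R) : continuous (fun t : R => atan ((c - t) / y)).
  move=> t; apply: (cvg_comp (fun t : R => (c - t) / y) atan); last exact: continuous_atan.
  by apply: cvgM; [apply: cvgB; [exact: cvg_cst|exact: cvg_id]|exact: cvg_cst].
by move=> t; apply: cvgB; exact: h.
Qed.

(** Tonelli's theorem for the kernel in [(t, x)]. The right-hand side depends on [sigma] only
    through its transform. *)
Lemma integral_atan_window (sigma : {finite_measure set (measurableTypeR R) -> \bar R})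
    (y a b : R) : 0 < y -> a < b ->
  (\int[sigma]_t (atan_window y a b t)%:E =
   \int[mu]_(x in `[a, b]) (complex.Im (stieltjes sigma (x +i* y)))%:E)%E.
Proof.
move=> y0 ab.
pose g (p : measurableTypeR R * measurableTypeR R) : \bar R :=
  (poisson p.2 y p.1 * \1_(`[a, b]%classic : set (measurableTypeR R)) p.2)%:E.
have g0 p : (0 <= g p)%E.
  by rewrite lee_fin mulr_ge0// ltW// poisson_gt0.
have mg : measurable_fun setT g.
  apply/measurable_EFinP; apply: measurable_funM.
    rewrite (_ : (fun p => _) = (poisson 0 y \o (fun p : measurableTypeR R * measurableTypeR R => p.1 - p.2 : measurableTypeR R))).
      apply: measurableT_comp; first by apply: continuous_measurable_fun; exact: continuous_poisson.
      by apply: measurable_funB; [exact: measurable_fst|exact: measurable_snd].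
    by apply/funext => p /=; rewrite /poisson subr0.
  by apply: measurableT_comp; [apply: measurable_indic; exact: measurable_itv|exact: measurable_snd].
have inner_t t : (\int[mu]_x g (t, x) = (atan_window y a b t)%:E)%E.
  transitivity (\int[mu]_(x in `[a, b]) (poisson t y x)%:E)%E.
    rewrite [RHS]integral_mkcond; apply: eq_integral => x _.
    rewrite patchE /g /= indicE poisson_sym; case: ifP => xI.
      by rewrite mulr1.
    by rewrite mulr0.
  rewrite /atan_window -seg_poisson// /seg /Rintegral fineK//.
  apply: integrable_fin_num => //; apply: continuous_seg_integrable.
  by apply: continuous_subspaceT; exact: continuous_poisson.
have inner_x x : (\int[sigma]_t g (t, x) =
   ((fun x => (complex.Im (stieltjes sigma (x +i* y)))%:E) \_ (`[a, b]%classic : set R)) x)%E.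
  rewrite patchE /g /= indicE; case: ifP => xI.
    by rewrite -poisson_stieltjes//; apply: eq_integral => t _; rewrite mulr1.
  by apply: integral0_eq => t _; rewrite mulr0.
have := fubini_tonelli (m1 := sigma) (m2 := mu) g mg g0.
under eq_integral do rewrite inner_t.
by under [in RHS]eq_integral do rewrite inner_x; rewrite -integral_mkcond.
Qed.

(* Shifting both endpoints to the right by much more than the width [y] of the
   kernel makes the limit the indicator of the half-open interval, even at the
   endpoints. *)
Lemma cvg_atan_window (a b t : R) : a < b ->
  atan_window (n.+1%:R ^- 2) (a + n.+1%:R^-1) (b + n.+1%:R^-1) t @[n --> \oo] -->
  (pi : R) * \1_(`]a, b]%classic : set R) t.
Proof.
move=> ab.
have h (c : R) : atan ((c + n.+1%:R^-1 - t) / n.+1%:R ^- 2) @[n --> \oo] -->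
   (if t <= c then pi / 2 else - (pi / 2)).
  have E (n : nat) : (c + n.+1%:R^-1 - t) / n.+1%:R ^- 2 = n.+1%:R * ((c - t) * n.+1%:R + 1).
    by have : n.+1%:R != 0 :> R by []; move: (n.+1%:R : R) => N N0; field.
  under eq_fun do rewrite E.
  case: ifPn => [tc|]; [|rewrite -ltNge => ct].
    apply: cvg_comp; last exact: cvgy_atan.
    apply/cvgryPge => A; near=> n.
    have hA : A <= n.+1%:R.
      by apply: (@le_trans _ _ n%:R); [near: n; exact: nbhs_infty_ger|rewrite ler_nat].
    apply: (le_trans hA); rewrite ler_peMr// lerDr mulr_ge0// subr_ge0//.
  under eq_fun do rewrite -[atan _]opprK -atanN.
  apply: cvgN; apply: cvg_comp; last exact: cvgy_atan.
  apply/cvgryPge => A; near=> n.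
  have N1 : 1 <= n.+1%:R :> R by rewrite ler1n.
  have : (1 + `|A|) / (t - c) <= n.+1%:R.
    by apply: (@le_trans _ _ n%:R); [near: n; exact: nbhs_infty_ger|rewrite ler_nat].
  rewrite ler_pdivrMr ?subr_gt0// => h1.
  have h2 := ler_norm A; have h3 := normr_ge0 A.
  have : `|A| <= n.+1%:R * (n.+1%:R * (t - c) - 1).
    by apply: (@le_trans _ _ (1 * `|A|)); [rewrite mul1r|apply: ler_pM => //; lra].
  lra.
rewrite /atan_window.
have -> : (pi : R) * \1_(`]a, b]%classic : set R) t =
   (if t <= b then pi / 2 else - (pi / 2)) - (if t <= a then pi / 2 else - (pi / 2)).
  rewrite indicE mem_setE in_itv/=.
  have [ta|ta] := leP t a; first by rewrite (le_trans ta (ltW ab)) /= mulr0 subrr.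
  by case: (t <= b) => /=; rewrite ?mulr1 ?mulr0; lra.
exact: cvgB.
Unshelve. all: by end_near. Qed.

(** The windows are bounded by [pi], integrable for a finite measure, so dominated convergence
    applies. *)
Lemma stieltjes_inversion (sigma : {finite_measure set (measurableTypeR R) -> \bar R}) (a b : R) :
  a < b ->
  (\int[mu]_(x in `[(a + n.+1%:R^-1)%R, (b + n.+1%:R^-1)%R])
     (complex.Im (stieltjes sigma (x +i* (n.+1%:R ^- 2))))%:E @[n --> \oo] -->
   (pi : R)%:E * sigma `]a, b]%classic)%E.
Proof.
move=> ab.
pose f (n : nat) (t : measurableTypeR R) :=
  (atan_window (n.+1%:R ^- 2) (a + n.+1%:R^-1) (b + n.+1%:R^-1) t)%:E.
pose f0 (t : measurableTypeR R) := ((pi : R) * \1_(`]a, b]%classic : set (measurableTypeR R)) t)%:E.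
have mI : measurable (`]a, b]%classic : set (measurableTypeR R)) by exact: measurable_itv.
have mf n : measurable_fun setT (f n).
  apply/measurable_EFinP; apply: continuous_measurable_fun; exact: continuous_atan_window.
have mf0 : measurable_fun setT f0.
  by apply/measurable_EFinP/measurable_funM => //; exact: measurable_indic.
have [|||] := @dominated_convergence _ (measurableTypeR R) R sigma setT measurableT f f0 (cst (pi : R)%:E) mf mf0.
- by apply: aeW => t _; apply/cvg_EFin; [exact: nearW|exact: cvg_atan_window].
- exact: integrable_cst_finite.
- apply: aeW => t n _; rewrite lee_fin /atan_window.
  have h1 := atan_gtNpi2; have h2 := atan_ltpi2.
  set u := atan _; set v := atan _.
  have := h1 R ((b + n.+1%:R^-1 - t) / n.+1%:R ^- 2); have := h2 R ((b + n.+1%:R^-1 - t) / n.+1%:R ^- 2).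
  have := h1 R ((a + n.+1%:R^-1 - t) / n.+1%:R ^- 2); have := h2 R ((a + n.+1%:R^-1 - t) / n.+1%:R ^- 2).
  rewrite -/u -/v ler_norml => *; apply/andP; split; lra.
move=> _ _; rewrite /f0.
have -> : (\int[sigma]_t ((pi : R) * \1_(`]a, b]%classic : set (measurableTypeR R)) t)%:E = (pi : R)%:E * sigma `]a, b]%classic)%E.
  under eq_integral do rewrite EFinM.
  rewrite ge0_integralZl_EFin ?pi_ge0//; last by apply/measurable_EFinP; exact: measurable_indic.
  by rewrite integral_indic// setIT.
apply: cvg_trans; apply: near_eq_cvg; apply: nearW => n /=.
by rewrite /f integral_atan_window// ltrD2r.
Qed.

(** Inversion recovers the mass of every half-open interval; these intervals are stable under
    intersection and generate the Borel sets. *)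
Lemma stieltjes_inj (sigma sigma' : {finite_measure set (measurableTypeR R) -> \bar R}) :
  (forall z : C, 0 < complex.Im z -> stieltjes sigma' z = stieltjes sigma z) ->
  forall A : set (measurableTypeR R), measurable A -> sigma' A = sigma A.
Proof.
move=> E A mA.
apply: (@measure_unique _ _ (measurableTypeR R) (@ocitv R)
   (fun n => `](- n%:R), n%:R]%classic)) => //.
- exact: ocitvI.
- by move=> n; exact: is_ocitv.
- exact: bigcup_itvT.
- move=> X [[a b] _ <-] /=; have [ab|ba] := ltP a b; last first.
    by rewrite set_itv_ge ?measure0// bnd_simp -leNgt.
  have h1 := stieltjes_inversion (sigma := sigma) ab; have := stieltjes_inversion (sigma := sigma') ab.
  under eq_fun do under eq_integral do (rewrite E; last by rewrite /= invr_gt0 exprn_gt0).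
  move=> h2.
  have : (pi%:E * sigma' `]a, b]%classic = pi%:E * sigma `]a, b]%classic)%E.
    exact: (cvg_unique (@ereal_hausdorff R) h2 h1).
  have mX := measurable_itv `]a, b].
  rewrite -(fineK (fin_num_measure sigma _ mX)) -(fineK (fin_num_measure sigma' _ mX)) -!EFinM.
  by move=> [] /(mulfI (lt0r_neq0 (pi_gt0 R))) ->.
- by move=> n; rewrite -ge0_fin_numE// fin_num_measure//; exact: measurable_itv.
Qed.

End StieltjesInversion.

(** * Conjugation symmetry and the expansion at infinity *)

Section Interpolation.
Context {R : realType}.
Local Notation C := (R[i]).
Local Notation normc := Normc.normc.

Lemma stieltjes_conj (sigma : {finite_measure set (measurableTypeR R) -> \bar R}) (z : C) :
  complex.Im z != 0 -> ((stieltjes sigma (z^*)%R)^*)%R = stieltjes sigma z.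
Proof.
move=> y0; rewrite conjCE /stieltjes /cintegral [complex.Re (_ +i* _)]/= [complex.Im (_ +i* _)]/=.
congr (_ +i* _).
  by apply: eq_Rintegral => t _; rewrite !cauchy_kernelE conjCE /= sqrrN.
rewrite -mulN1r -RintegralZl//.
  by apply: eq_Rintegral => t _; rewrite mulN1r !cauchy_kernelE conjCE /= sqrrN mulNr opprK.
have y1 : complex.Im (z^*)%R != 0 by rewrite conjCE /= oppr_eq0.
by have [] := cintegrable_cauchy sigma y1.
Qed.

Lemma moment_rem_expansion (n : nat) (s : nat -> R) (v z : C) : z != 0 ->
  z ^+ n * (v + \sum_(j < n) (s j)%:C / z ^+ j.+1) = moment_rem (cseq s) v z n.
Proof.
move=> z0; rewrite -[n in RHS]add0n moment_remD /= mulrDr; congr (_ + _).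
rewrite mulr_sumr; apply: eq_bigr => -[j jn] _ /=.
have {1}-> : n = (n.-1 - j + j.+1)%N by rewrite addnS subnK; case: n jn.
by rewrite exprD -mulrA [X in _ * X]mulrC divfK ?expf_neq0.
Qed.

End Interpolation.

Theorem theorem7p1 (R : realType) (n : nat) (s : nat -> R) (w : R[i] -> R[i])
    (hw : nevanlinna w)
    (hfmi : forall z : R[i], 0 < complex.Im z -> psdmx (fmi_mx n s w z)) :
  (exists sigma : {finite_measure set (measurableTypeR R) -> \bar R},
    [/\ represents sigma w,
        forall sigma' : {finite_measure set (measurableTypeR R) -> \bar R},
          represents sigma' w ->
          forall A : set (measurableTypeR R),
            measurable A -> sigma' A = sigma A,
        forall k : nat, (k <= 2 * n)%N -> has_moment sigma k,
        forall k : nat, (k < 2 * n)%N -> moment sigma k = s k &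
        moment sigma (2 * n)%N <= s (2 * n)%N]) /\
  interpolation_cond n s w.
Proof.
have [hol sym pos] := hw.
have wi (z : R[i]) : 0 < complex.Im z -> 0 <= complex.Im (w z).
  move=> z0; have zn0 : complex.Im z != 0 by rewrite gt_eqF.
  by have := pos z zn0; rewrite divr_conj// ler0c pmulr_lge0 ?invr_gt0.
have wd (z : R[i]) : 0 < complex.Im z -> derivable (w : R[i]^o -> R[i]^o) z 1.
  by move=> z0; apply: hol; rewrite gt_eqF.
have [sigma sE] := herglotz wd wi (fmi_normc hfmi).
(* The matrix inequality speaks of the upper half-plane only; the lower one is reached by the
   symmetry of [w] and of the transform. *)
have rep : represents sigma w.
  move=> z zn0; have [z0|z0] := ltP 0 (complex.Im z); first exact: sE.
  rewrite sym// sE ?stieltjes_conj//.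
  by rewrite conjCE /= oppr_gt0 lt_neqAle zn0.
have [hm meq mle] := fmi_moments hfmi sE.
have bnd (y : R) : y != 0 -> interpolation_bound n s w (0 +i* y) 0.
  move=> y0; set z : R[i] := 0 +i* y.
  have zn0 : complex.Im z != 0 by [].
  have z0 : z != 0 by apply: contra zn0 => /eqP ->.
  have nz : Normc.normc z = `|y| by rewrite /= expr0n add0r sqrtr_sqr.
  rewrite /interpolation_bound mul2n moment_rem_expansion// rep// moment_rem_cauchy//; last first.
    by move=> j jn; split; [exact/hm/ltnW|exact: meq].
  rewrite !normrcE nz addr0 mulr1 -fmorphV -rmorphM lecR.
  apply: le_trans (normc_moment_cauchy zn0 (hm _ (leqnn _))) _.
  by rewrite ler_wpM2r// invr_ge0.
split.
  exists sigma; split => //; try by rewrite mul2n.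
  move=> sigma' rep' A mA; apply: stieltjes_inj => // z z0.
  by rewrite -rep -?rep'// gt_eqF.
exists (fun=> 0); split; [exact: cvg_cst|exact: cvg_cst| |].
  near=> y; apply: bnd; rewrite gt_eqF//; near: y; exact: nbhs_pinfty_gt.
near=> y; apply: bnd; rewrite lt_eqF//; near: y; exact: nbhs_ninfty_lt.
Unshelve. all: by end_near. Qed.
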